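(* Given an integer $k\ge 4$ and a constant $\gamma>0$, there exists an integer $n_0=n_0(k,\gamma)$ such that for all $n\ge n_0$ with $(k+1)\mid n$, $$t^k(n,k+1)\le\left(1-\frac{k+\mathbf{1}_{k,\mathrm{odd}}}{2k^2}+\gamma\right)n,$$ where $\mathbf{1}_{k,\mathrm{odd}}=1$ if $k$ is odd and $\mathbf{1}_{k,\mathrm{odd}}=0$ otherwise. Moreover, if $k$ is even, then $t^k(n,k+1)\ge 2n/3$ for all such $n$.
   Context: A $k$-graph $H$ is a pair $(V(H),E(H))$ with $V(H)$ finite and $E(H)\subseteq\binom{V(H)}{k}$; its order is $|V(H)|$. For a $(k-1)$-set $T\subseteq V(H)$, $\deg(T)$ is the number of vertices $v$ such that $T\cup\{v\}$ is an edge, and $\delta_{k-1}(H)$ is the minimum of $\deg(T)$ over all $(k-1)$-sets $T$. $K_t^k$ is the complete $k$-graph on $t$ vertices. An $F$-factor in $H$ is a spanning subgraph consisting of vertex-disjoint copies of $F$. For $t\mid n$, $t^k(n,t)$ is the smallest integer $d$ such that every $k$-graph $H$ of order $n$ with $\delta_{k-1}(H)\ge d$ contains a $K_t^k$-factor. *)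

(* Defs.v *)
From mathcomp Require Import all_boot all_order all_algebra.
From mathcomp Require Import boolp reals.

Set Implicit Arguments.
Unset Strict Implicit.
Unset Printing Implicit Defensive.

Record kgraph (k : nat) := KGraph {
  vert : finType;
  edges : {set {set vert}};
  edges_uniform : forall e : {set vert}, e \in edges -> #|e| = k
}.

Definition order (k : nat) (H : kgraph k) : nat := #|vert H|.

(* If v lies in T then v |: T = T has too few elements to be an edge, so only
   vertices outside the (k-1)-set T are counted. *)
Definition codeg (k : nat) (H : kgraph k) (T : {set vert H}) : nat :=
  #|[set v : vert H | v |: T \in edges H]|.

(* Every codegree is at most [order H], so taking [order H] as the neutral
   element of the minimum matters only when there is no (k-1)-set at all. *)
Definition min_codeg (k : nat) (H : kgraph k) : nat :=
  \big[minn/order H]_(T : {set vert H} | #|T| == k.-1) codeg T.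

Lemma complete_uniform (k t : nat) (e : {set 'I_t}) :
  e \in [set e : {set 'I_t} | #|e| == k] -> #|e| = k.
Proof. by rewrite inE => /eqP. Qed.

Definition complete (k t : nat) : kgraph k := KGraph (@complete_uniform k t).

(* [f] embeds [F] onto a (not necessarily induced) copy of [F] in [H]
   whose vertex set is [B]. *)
Definition is_copy_on (k : nat) (F H : kgraph k) (f : vert F -> vert H)
    (B : {set vert H}) : Prop :=
  [/\ injective f, f @: [set: vert F] = B &
      forall e : {set vert F}, e \in edges F -> f @: e \in edges H].

(* A factor is given by the partition of the vertices of [H] into the vertex
   sets of its copies of [F]. *)
Definition has_factor (k : nat) (F H : kgraph k) : Prop :=
  exists2 P : {set {set vert H}}, partition P [set: vert H] &
    forall B : {set vert H}, B \in P ->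
      exists f : vert F -> vert H, is_copy_on f B.

Definition forces_clique_factor (k n t d : nat) : Prop :=
  forall H : kgraph k, order H = n -> d <= min_codeg H ->
    has_factor (complete k t) H.

Lemma min_codeg_le_order (k : nat) (H : kgraph k) : min_codeg H <= order H.
Proof.
apply: (big_ind (fun m => m <= order H)) => // [m p hm _|T _].
- exact: leq_trans (geq_minl m p) hm.
- exact: max_card.
Qed.

Lemma ex_forces_clique_factor (k n t : nat) :
  exists d, `[< forces_clique_factor k n t d >].
Proof.
exists n.+1; apply/asboolP => H <- hd.
by have := leq_trans hd (min_codeg_le_order H); rewrite ltnn.
Qed.

(* The number t^k(n, t). *)
Definition clique_factor_threshold (k n t : nat) : nat :=
  ex_minn (ex_forces_clique_factor k n t).

Lemma clique_factor_thresholdP (k n t : nat) :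
  forces_clique_factor k n t (clique_factor_threshold k n t) /\
  (forall d, forces_clique_factor k n t d ->
     clique_factor_threshold k n t <= d).
Proof.
rewrite /clique_factor_threshold; case: ex_minnP => m /asboolP hm min_m.
by split=> // d hd; apply: min_m; apply/asboolP.
Qed.

(* Main.v *)
Require Import Defs.
From mathcomp Require Import all_boot all_order all_algebra.
From mathcomp Require Import boolp reals.
From mathcomp Require Import zify ring lra.

(** Write n for the order of the k-graph H, e for n minus its minimum codegree,
and call a (k+1)-set a clique when all its k-subsets are edges. A factor is a
partition of the vertices into cliques; a set with such a partition is called
tileable. Random tuples of vertices are handled by the operator [mean], and a
configuration is called dense when a random tuple of the right length realises
it with probability bounded below.

Upper bound, [tileable_of_codegree]. The hypothesis gives
e <= (k + 1_odd) n / (2 k^2) - gamma n / 2, and the proof is by absorption. A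
small set Z is built such that Z together with X is tileable for every X which
is disjoint from Z and consists of boundedly many groups of k+1 vertices. Outside
Z, disjoint cliques are found that cover all but boundedly many vertices, and Z
absorbs the vertices that they leave.

To build Z, say that a tuple t links x and y if x, t and y, t both span tileable
sets. If x_0, ..., x_k are given, y_0, ..., y_k is a clique and t_i links x_i and
y_i, then the set of all y_i and t_i is tileable both alone and together with
the x_i. So if every pair of vertices is linked by a dense set of tuples, every
(k+1)-set is absorbed by a dense set of tuples. Some tuple therefore serves a
fixed proportion d of the (k+1)-sets that are not served yet ([absorber_step]).
As (1 - d)^m n^(k+1) < 1 already when m is a small multiple of n, few repetitions
serve all of them ([absorbing_set]).

That all pairs are linked densely, [linked_dense], is the heart of the matter.
Call x and y adjacent if a dense set of k-tuples forms a clique with either of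
them. An edge forms a clique with at least n - k e > n / 3 vertices, so among
any three vertices two are adjacent ([colink_ternary]). If x and y are adjacent,
or have many common neighbours, they are linked densely. Otherwise their private
neighbourhoods P and Q cover almost everything, and it is enough to find many
k-sets that form a clique both with a vertex of P and with a vertex of Q. Let K
be a clique with a vertices in P and b in Q, where a + b = k + 1. Every pair
u, v of K makes at most e vertices unusable, and these obstruct both K - u and
K - v; when u and v lie on the same side one obstructed vertex is lost twice,
and when they lie on opposite sides it is lost only once. Counting the vertices
that can replace some v of K from the side opposite to v therefore gives at least
a |Q| + b |P| - e (k (k+1) - a b) ([opposite_ext_bound]). If a >= b >= 1 and
|P| <= |Q|, then a b >= k, and the bound is at least about
(k+1) n / 2 - k^2 e, which is a positive multiple of n by the hypothesis.

For the cover, [almost_tiling], take a largest tileable subset U of W. If many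
vertices remain, they contain many disjoint (k-1)-sets T. Each T is completed to
a clique by more than a proportion 2 / (k+1) of all pairs, because
(1 - eps) (1 - k eps) > 2 / (k+1) for eps = (k + 1_odd) / (2 k^2) and k >= 4.
Split the pairs between two blocks A and B of the tiling into k+1 perfect
matchings. Some matching has three good pairs for very many T, and the same
three pairs serve three of these T. Replacing A and B by the three resulting
cliques enlarges U.

Lower bound, [exists_uncoverable]. Fix a vertex x and a set L of vertex sets. Let
a k-set S be an edge if either x is in S and L contains S - x, or x is not in S
and some (k-1)-subset of S is outside L. No clique contains x, so there is no
factor. For random L of density 13/19, a (k-1)-set through x misses a proportion
6/19 of the vertices on average, and one that avoids x misses at most
(13/19)^3. Both numbers are below 1/3, so by a Chernoff bound and a union bound
some L gives minimum codegree at least 2 n / 3. *)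

Set Implicit Arguments.
Unset Strict Implicit.
Unset Printing Implicit Defensive.
Import Order.TTheory GRing.Theory Num.Theory.
Local Open Scope ring_scope.

(** * Cliques and tilings *)

Section Cliques.
Local Open Scope nat_scope.
Variables (k : nat) (H : kgraph k).
Local Notation V := (vert H).
Implicit Types (A B K S T Q : {set V}) (u v w x y z : V) (s t : seq V).

(** The vertices of T itself are included, so that this is exactly the complement
of the set counted by the codegree of T. *)
Definition bad T : {set V} := [set v | v |: T \notin edges H].

Definition clique K := (#|K| == k.+1) && [forall v in K, K :\ v \in edges H].

Definition ext S : {set V} := [set v | (v \notin S) && clique (v |: S)].

Definition tileable A :=
  [exists P : {set {set V}}, partition P A && [forall K in P, clique K]].

Lemma clique_card K : clique K -> #|K| = k.+1.
Proof. by case/andP => /eqP. Qed.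

Lemma clique_edge K v : clique K -> v \in K -> K :\ v \in edges H.
Proof. by case/andP => _ /forall_inP; apply. Qed.

Lemma bad_self T v : #|T| < k -> v \in T -> v \in bad T.
Proof.
move=> Tk vT; rewrite inE (setUidPr _) ?sub1set //.
by apply/negP => /edges_uniform Tk'; rewrite Tk' ltnn in Tk.
Qed.

Lemma codeg_bad T : codeg T + #|bad T| = #|V|.
Proof.
have -> : bad T = ~: [set v | v |: T \in edges H] by apply/setP => v; rewrite !inE.
exact: cardsC.
Qed.

Lemma min_codeg_le T : #|T| = k.-1 -> min_codeg H <= codeg T.
Proof.
move=> cT; rewrite /min_codeg; have := mem_index_enum T.
elim: (index_enum _) => // S s IHs; rewrite inE big_cons => /predU1P[<-|/IHs h].
  by rewrite cT eqxx geq_minl.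
by case: ifP => // _; apply: leq_trans (geq_minr _ _) h.
Qed.

Lemma card_bad T : #|T| = k.-1 -> #|bad T| <= #|V| - min_codeg H.
Proof. by move/min_codeg_le; have := codeg_bad T; lia. Qed.

Lemma clique_ext S v : 1 < k -> S \in edges H ->
  {in S, forall u, v \notin bad (S :\ u)} -> v \in ext S.
Proof.
move=> k1 SE vS; have cS := edges_uniform SE.
have vNS : v \notin S.
  apply/negP => vS'; have [u] : exists u, u \in S :\ v.
    by apply/set0Pn; rewrite -card_gt0; have := cardsD1 v S; rewrite vS' cS; lia.
  rewrite !inE => /andP[uv uS]; move/negP: (vS u uS); apply.
  apply: bad_self; last by rewrite !inE vS' eq_sym uv.
  by have := cardsD1 u S; rewrite uS cS; lia.
rewrite inE vNS /=; apply/andP; split; first by rewrite cardsU1 vNS cS.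
apply/forall_inP => u; rewrite !inE => /orP[/eqP ->|uS].
  by rewrite setU1K.
have uv : v != u by apply: contraNneq vNS => ->.
have -> : (v |: S) :\ u = v |: (S :\ u).
  by apply/setP => w; rewrite !inE; case: (eqVneq w v) => // ->; rewrite uv.
by have := vS u uS; rewrite inE negbK.
Qed.

(** A vertex that does not extend the edge S to a clique is bad for one of the
facets of S. *)
Lemma ext_bound S Q : 1 < k -> S \in edges H ->
  #|Q| <= #|ext S :&: Q| + \sum_(u in S) #|bad (S :\ u) :&: Q|.
Proof.
move=> k1 SE; rewrite -(cardsID (ext S) Q) setIC leq_add2l.
have : Q :\: ext S \subset \bigcup_(u in S) (bad (S :\ u) :&: Q).
  apply/subsetP => v; rewrite inE => /andP[vNe vQ].
  case: (boolP [exists u in S, v \in bad (S :\ u)]) => [/exists_inP[u uS vb]|].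
    by apply/bigcupP; exists u => //; rewrite inE vb.
  rewrite negb_exists => /forallP ne; case/negP: vNe; apply: clique_ext => // u uS.
  by have := ne u; rewrite uS.
move/subset_leq_card/leq_trans; apply.
elim/big_rec2: _ => [|u m B _ IH]; first by rewrite cards0.
by apply: leq_trans (leq_card_setU _ _) _; rewrite leq_add2l.
Qed.

Lemma tileable0 : tileable set0.
Proof.
apply/existsP; exists set0; rewrite /partition inE andbT.
apply/andP; split; last by apply/forall_inP => K; rewrite inE.
by rewrite /cover big_set0 eqxx; apply/trivIsetP => A; rewrite inE.
Qed.

Lemma tileableP A : reflect
  (exists2 P, partition P A & {in P, forall K, clique K}) (tileable A).
Proof.
apply: (iffP existsP) => [[P /andP[pP /forall_inP cP]]|[P pP cP]]; exists P => //.
by rewrite pP; apply/forall_inP.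
Qed.

Lemma clique_tileable K : clique K -> tileable K.
Proof.
move=> cK; apply/tileableP; exists [set K]; last by move=> B /set1P ->.
apply/and3P; split; first by rewrite /cover big_set1.
  by apply/trivIsetP => A B /set1P -> /set1P ->; rewrite eqxx.
by rewrite inE eq_sym -card_gt0 (clique_card cK).
Qed.

Lemma tileableU A B : [disjoint A & B] -> tileable A -> tileable B ->
  tileable (A :|: B).
Proof.
move=> dAB /tileableP[P /and3P[/eqP cP tP P0] kP].
move=> /tileableP[Q /and3P[/eqP cQ tQ Q0] kQ].
apply/tileableP; exists (P :|: Q); last first.
  by move=> K /setUP[/kP|/kQ].
apply/and3P; split.
- by rewrite /cover bigcup_setU -!/(cover _) cP cQ.
- by apply: trivIsetU => //; rewrite cP cQ.
- by rewrite inE negb_or P0.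
Qed.

Lemma tileable_card A : tileable A -> k.+1 %| #|A|.
Proof.
move=> /tileableP[P pP kP]; rewrite (@card_uniform_partition _ k.+1 P) //.
  exact: dvdn_mull.
by move=> K /kP/clique_card.
Qed.

Lemma clique_copy K : clique K ->
  exists f : vert (complete k k.+1) -> V, is_copy_on f K.
Proof.
move=> cK; have cardK := clique_card cK.
pose f (i : 'I_k.+1) : V := enum_val (cast_ord (esym cardK) i).
have f_inj : injective f by move=> i j /enum_val_inj/cast_ord_inj.
have fT : f @: setT = K.
  apply/eqP; rewrite eqEcard card_imset // cardsT card_ord cardK leqnn andbT.
  by apply/subsetP => _ /imsetP[i _ ->]; apply: enum_valP.
exists f; split => // e; rewrite inE => /eqP ek.
have /cards1P[j ej] : #|~: e| == 1%N by have := cardsC e; rewrite ek card_ord; lia.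
have -> : f @: e = K :\ f j.
  rewrite -fT -[e]setCK ej; apply/setP => v; rewrite !inE.
  apply/imsetP/andP => [[i]|[vj /imsetP[i _ vi]]].
    by rewrite !inE => ij ->; rewrite (inj_eq f_inj) ij imset_f.
  by exists i; rewrite // !inE; apply: contraNneq vj => <-; rewrite vi.
by apply: clique_edge => //; rewrite -fT imset_f.
Qed.

Lemma copy_clique K (f : vert (complete k k.+1) -> V) : is_copy_on f K -> clique K.
Proof.
move=> [f_inj fT fE]; apply/andP; split.
  by rewrite -fT card_imset // cardsT card_ord.
apply/forall_inP => v; rewrite -fT => /imsetP[j _ ->].
have -> : (f @: setT) :\ f j = f @: (setT :\ j).
  apply/setP => w; rewrite !inE; apply/andP/imsetP => [[wj /imsetP[i _ wi]]|[i]].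
    by exists i; rewrite // !inE andbT; apply: contraNneq wj => <-; rewrite wi.
  by rewrite !inE andbT => ij ->; rewrite (inj_eq f_inj) ij imset_f.
apply: fE; rewrite inE; have := cardsD1 j setT; rewrite cardsT card_ord inE.
by move=> e; rewrite -eqSS -add1n -e.
Qed.

Lemma tileable_factor : tileable [set: V] -> has_factor (complete k k.+1) H.
Proof.
by case/tileableP => P pP kP; exists P => // B /kP/clique_copy.
Qed.

End Cliques.

(** * Means over random tuples of vertices *)

Section Mean.
Variables (R : realFieldType) (V : finType).
Implicit Types (f g : V -> R) (F G : seq V -> R) (s : nat) (t u l : seq V).

Definition avg f : R := (\sum_v f v) / #|V|%:R.

(** The expectation of F at a tuple of s independent uniform vertices. As an
iterated average it gives Fubini by [mean_cat] and conditioning on the first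
entries by computation. *)
Fixpoint mean s F : R :=
  if s is s'.+1 then avg (fun v => mean s' (fun t => F (v :: t))) else F [::].

Lemma eq_avg f g : f =1 g -> avg f = avg g.
Proof. by move=> fg; congr (_ / _); apply: eq_bigr => v _. Qed.

Lemma avg_le f g : (forall v, f v <= g v) -> avg f <= avg g.
Proof. by move=> fg; rewrite ler_wpM2r ?invr_ge0 // ler_sum. Qed.

Lemma avg_ge0 f : (forall v, 0 <= f v) -> 0 <= avg f.
Proof. by move=> f0; rewrite divr_ge0 // sumr_ge0. Qed.

Lemma avgD f g : avg (fun v => f v + g v) = avg f + avg g.
Proof. by rewrite /avg big_split mulrDl. Qed.

Lemma avgZ c f : avg (fun v => c * f v) = c * avg f.
Proof. by rewrite /avg -mulr_sumr mulrA. Qed.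

Lemma avg_mem (A : {set V}) : avg (fun v => (v \in A)%:R) = #|A|%:R / #|V|%:R.
Proof.
rewrite /avg -natr_sum -sum1_card [in RHS]big_mkcond /=.
by congr (_%:R / _); apply: eq_bigr => v _; case: (v \in A).
Qed.

Lemma avg_swap (f : V -> V -> R) :
  avg (fun v => avg (f v)) = avg (fun w => avg (fun v => f v w)).
Proof. by rewrite /avg -!mulr_suml exchange_big. Qed.

Lemma avg_mem_ge (A : {set V}) c f : 0 <= c -> (forall v, 0 <= f v) ->
  {in A, forall v, c <= f v} -> c * (#|A|%:R / #|V|%:R) <= avg f.
Proof.
move=> c0 f0 fc; rewrite -avg_mem -avgZ; apply: avg_le => v.
by case: (boolP (v \in A)) => [/fc|_]; rewrite ?mulr1 ?mulr0.
Qed.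

Lemma eq_mean s F G : (forall t, size t = s -> F t = G t) -> mean s F = mean s G.
Proof.
elim: s F G => [|s IHs] F G FG /=; first exact: FG.
by apply: eq_avg => v; apply: IHs => t st; apply: FG; rewrite /= st.
Qed.

Lemma mean_le s F G : (forall t, size t = s -> F t <= G t) -> mean s F <= mean s G.
Proof.
elim: s F G => [|s IHs] F G FG /=; first exact: FG.
by apply: avg_le => v; apply: IHs => t st; apply: FG; rewrite /= st.
Qed.

Lemma meanD s F G : mean s (fun t => F t + G t) = mean s F + mean s G.
Proof.
elim: s F G => [|s IHs] F G //=; rewrite -avgD.
by apply: eq_avg => v; rewrite IHs.
Qed.

Lemma meanZ s c F : mean s (fun t => c * F t) = c * mean s F.
Proof.
elim: s F => [|s IHs] F //=; rewrite -avgZ.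
by apply: eq_avg => v; rewrite IHs.
Qed.

Lemma mean_ge0 s F : (forall t, size t = s -> 0 <= F t) -> 0 <= mean s F.
Proof.
elim: s F => [|s IHs] F F0 /=; first exact: F0.
by apply: avg_ge0 => v; apply: IHs => t st; apply: F0; rewrite /= st.
Qed.

Lemma mean_cat s1 s2 F :
  mean (s1 + s2) F = mean s1 (fun t => mean s2 (fun u => F (t ++ u))).
Proof. by elim: s1 F => //= s IHs F; apply: eq_avg => v; rewrite IHs. Qed.

Lemma avg_mean_swap s (F : V -> seq V -> R) :
  avg (fun v => mean s (F v)) = mean s (fun t => avg (fun v => F v t)).
Proof.
elim: s F => //= s IHs F; rewrite avg_swap; apply: eq_avg => w.
exact: IHs.
Qed.

(** Any one coordinate may be drawn last. *)
Lemma mean_insert i s F : (i <= s)%N ->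
  mean s.+1 F = mean s (fun t => avg (fun v => F (take i t ++ v :: drop i t))).
Proof.
elim: i s F => [|i IHi] s F is_.
  by rewrite /= avg_mean_swap; apply: eq_mean => t _; rewrite take0 drop0.
case: s is_ => // s is_; apply: eq_avg => w.
exact: (IHi s (fun t => F (w :: t))).
Qed.

Lemma mean_sum s (I : finType) (F : I -> seq V -> R) :
  mean s (fun t => \sum_i F i t) = \sum_i mean s (F i).
Proof.
elim: s F => //= s IHs F; rewrite /avg -mulr_suml exchange_big /=.
by congr (_ / _); apply: eq_bigr => v _; rewrite IHs.
Qed.

Lemma mean_prod s1 s2 F G :
  mean (s1 + s2) (fun t => F (take s1 t) * G (drop s1 t)) = mean s1 F * mean s2 G.
Proof.
rewrite mean_cat mulrC -meanZ; apply: eq_mean => t st.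
rewrite mulrC -meanZ; apply: eq_mean => u _.
by rewrite take_size_cat // drop_size_cat.
Qed.

Hypothesis V_gt0 : (0 < #|V|)%N.
Let n_gt0 : 0 < #|V|%:R :> R. Proof. by rewrite ltr0n. Qed.
Let n_neq0 : #|V|%:R != 0 :> R. Proof. by rewrite lt0r_neq0. Qed.

Lemma avg_const c : avg (fun _ => c) = c.
Proof. by rewrite /avg sumr_const -[_ *+ _]mulr_natr mulfK. Qed.

Lemma mean_const s c : mean s (fun _ => c) = c.
Proof. by elim: s => //= s ->; rewrite avg_const. Qed.

(** The first moment method. *)
Lemma mean_ex s c F : c <= mean s F -> exists2 t, size t = s & c <= F t.
Proof.
move=> cF; apply: contrapT => noF.
have Fc t : size t = s -> F t < c.
  by move=> st; rewrite ltNge; apply/negP => cFt; apply: noF; exists t.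
have: mean s F < c; last by rewrite ltNge cF.
elim: s F {cF noF} Fc => [|s IHs] F Fc /=; first exact: Fc.
have lt_v v : mean s (fun t => F (v :: t)) < c.
  by apply: IHs => t st; apply: Fc; rewrite /= st.
rewrite -[ltRHS]avg_const /avg ltr_pM2r ?invr_gt0 //.
have [v _] := card_gt0P V_gt0.
rewrite (bigD1 v) //= [ltRHS](bigD1 v) //=.
by apply: ltr_leD => //; apply: ler_sum => w _; apply: ltW.
Qed.

Lemma mean_hit s (D : {set V}) :
  mean s (fun t => (has (mem D) t)%:R) <= s%:R * (#|D|%:R / #|V|%:R).
Proof.
elim: s => [|s IHs] /=; first by rewrite mul0r.
rewrite -natr1 mulrDl mul1r addrC.
apply: le_trans (lerD (lexx _) IHs); rewrite -avg_mem.
rewrite -[X in _ + X](avg_const) -avgD; apply: avg_le => v.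
rewrite -[X in X + _](mean_const s) -meanD; apply: mean_le => t _.
by rewrite -natrD ler_nat; case: (v \in D); case: (has _ t).
Qed.

(** Union bound over all pairs of positions. As the right-hand side tends to 0
when #|V| grows, degenerate tuples never matter for density. *)
Lemma mean_collision s l :
  mean s (fun t => (~~ uniq t || has (mem l) t)%:R)
    <= s%:R * (s + size l)%:R / #|V|%:R.
Proof.
elim: s => [|s IHs] /=; first by rewrite !mul0r.
rewrite avg_mean_swap.
set F := fun t => _ in IHs.
have leF t : size t = s ->
  avg (fun v => (~~ ((v \notin t) && uniq t) || ((v \in l) || has (mem l) t))%:R)
    <= F t + (s + size l)%:R / #|V|%:R.
  move=> st; have := avg_mem [set v | v \in t ++ l].
  move=> hv; apply: (@le_trans _ _ (F t + #|[set v | v \in t ++ l]|%:R / #|V|%:R)).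
    rewrite -hv -[F t](avg_const) -avgD; apply: avg_le => v.
    rewrite inE mem_cat /F -natrD ler_nat.
    by case: (v \in t); case: (uniq t); case: (v \in l); case: (has _ t).
  rewrite lerD2l ler_wpM2r ?invr_ge0 // ler_nat -st -size_cat.
  by rewrite cardsE; apply: card_size.
apply: le_trans (mean_le leF) _; rewrite meanD mean_const.
apply: le_trans (lerD IHs (lexx _)) _.
rewrite -mulrDl ler_wpM2r ?invr_ge0 // -natrM -natrD -natrM ler_nat.
by nia.
Qed.

Lemma mean_all s (A : {set V}) :
  mean s (fun t => (all (mem A) t)%:R) = (#|A|%:R / #|V|%:R) ^+ s.
Proof.
elim: s => [|s IHs] //=; rewrite exprS -IHs -avg_mem mulrC -avgZ.
apply: eq_avg => v; rewrite mulrC -meanZ; apply: eq_mean => t _.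
by rewrite -natrM mulnb.
Qed.

End Mean.

(** * Tuples spanning cliques and tilings *)

Section Tuples.
Variables (k : nat) (H : kgraph k).
Local Notation V := (vert H).
Implicit Types (x y p q : V) (s t : seq V).

Definition clique_seq s := clique [set v in s].

Lemma clique_seq_uniq s : size s = k.+1 -> clique_seq s -> uniq s.
Proof. by move=> ss /clique_card; rewrite cardsE -ss => /card_uniqP. Qed.

Lemma clique_seq_edge x s : size s = k -> clique_seq (x :: s) ->
  [set v in s] \in edges H.
Proof.
move=> ss cxs; have /= /andP[xs _] : uniq (x :: s) by apply: clique_seq_uniq; rewrite //= ss.
rewrite -(@setU1K _ x [set v in s]) ?inE //; apply: clique_edge; last by rewrite !inE eqxx.
by have <- : [set v in x :: s] = x |: [set v in s] by apply/setP => v; rewrite !inE.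
Qed.

Lemma ext_clique_seq x s : x \in ext [set v in s] -> clique_seq (x :: s).
Proof.
rewrite inE => /andP[_]; rewrite /clique_seq.
by have -> : [set v in x :: s] = x |: [set v in s] by apply/setP => v; rewrite !inE.
Qed.

Definition tileable_seq s := tileable [set v in s].

Lemma tileable_seq_cat s t : uniq (s ++ t) -> tileable_seq s -> tileable_seq t ->
  tileable_seq (s ++ t).
Proof.
rewrite cat_uniq => /and3P[_ st _] ts tt.
have -> : tileable_seq (s ++ t) = tileable ([set v in s] :|: [set v in t]).
  by congr tileable; apply/setP => v; rewrite !inE mem_cat.
apply: tileableU => //; rewrite disjoint_sym disjoint_subset; apply/subsetP => v.
by rewrite !inE => vt; apply: contra st => vs; apply/hasP; exists v.
Qed.

Lemma eq_tileable_seq s t : s =i t -> tileable_seq s = tileable_seq t.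
Proof. by move=> st; congr tileable; apply/setP => v; rewrite !inE st. Qed.

Lemma clique_seq_tileable s : clique_seq s -> tileable_seq s.
Proof. exact: clique_tileable. Qed.

Definition join s1 p s q s2 : seq V := s1 ++ p :: s ++ q :: s2.

(** The three cliques may be attached to the vertices x, p, q in any order abc,
so that one tuple is tiled in different ways together with different vertices. *)
Lemma tileable_join x s1 p s q s2 a b c : perm_eq [:: a; b; c] [:: x; p; q] ->
  uniq (x :: join s1 p s q s2) ->
  clique_seq (a :: s1) -> clique_seq (b :: s) -> clique_seq (c :: s2) ->
  tileable_seq (x :: join s1 p s q s2).
Proof.
move=> /permP abc; set t := _ :: _ => ut h1 h2 h3.
have pt : perm_eq ((a :: s1) ++ (b :: s) ++ (c :: s2)) t.
  apply/permP => A; have := abc A; rewrite /t /join /= !count_cat /= !count_cat /=.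
  by clear; lia.
rewrite -(eq_tileable_seq (perm_mem pt)); rewrite -(perm_uniq pt) in ut.
apply: tileable_seq_cat => //; first exact: clique_seq_tileable.
move: ut; rewrite cat_uniq => /and3P[_ _ ut].
by apply: tileable_seq_cat => //; apply: clique_seq_tileable.
Qed.

(** The vertices x and y can replace one another in a tiling that uses t. *)
Definition linked x y t := [&& uniq (x :: t), uniq (y :: t),
  tileable_seq (x :: t) & tileable_seq (y :: t)].

Lemma linked_sym x y t : linked x y t = linked y x t.
Proof. by rewrite /linked andbCA [tileable_seq (x :: t) && _]andbC. Qed.

(** Together with x the tuple is tiled by x s1, p s, q s2; together with y the
three vertices y, p, q are redistributed over s1, s, s2. The order abc records
in which way y enters. *)
Lemma linked_join x y s1 p s q s2 a b c : perm_eq [:: a; b; c] [:: y; p; q] ->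
  let t := join s1 p s q s2 in uniq (x :: t) -> uniq (y :: t) ->
  [&& clique_seq (x :: s1), clique_seq (p :: s), clique_seq (q :: s2),
      clique_seq (a :: s1), clique_seq (b :: s) & clique_seq (c :: s2)] ->
  linked x y t.
Proof.
move=> abc t ux uy /and5P[h1 h2 h3 h4 /andP[h5 h6]]; apply/and4P; split=> //.
  exact: (tileable_join (perm_refl _) ux h1 h2 h3).
exact: (tileable_join abc uy h4 h5 h6).
Qed.

End Tuples.

(** * Linking two vertices *)

Lemma card3_le (T : finType) (A B C : {set T}) :
  (#|A| + #|B| + #|C| <= #|T| + #|A :&: B| + #|B :&: C| + #|A :&: C|)%N.
Proof.
have h1 := cardsUI A B; have h2 := cardsUI (A :|: B) C.
have h3 : (#|(A :|: B) :&: C| <= #|A :&: C| + #|B :&: C|)%N.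
  by rewrite setIUl leq_card_setU.
have h4 : (#|(A :|: B) :|: C| <= #|T|)%N := max_card _; lia.
Qed.

Lemma pairs_le (a b c a' b' c' : bool) :
  (a -> a') -> (b -> b') -> (c -> c') ->
  ((a && b) + (b && c) + (a && c) <= (a' && b') + (b' && c') + (a' && c'))%N.
Proof.
have le (x y x' y' : bool) : (x -> x') -> (y -> y') -> (x && y <= x' && y')%N.
  by case: x => // /(_ isT) ->; case: y => // /(_ isT) ->.
by move=> ha hb hc; rewrite !leq_add // le.
Qed.

(** From a + b = k + 1 and a, b >= 1 one gets a b >= k, and from a >= b and
p <= q one gets 2 (a q + b p) >= (a + b) (p + q). *)
Lemma opposite_arith (k a b p q e s : nat) :
  (a + b = k.+1 -> 1 <= b -> b <= a -> p <= q ->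
   a * q + b * p + e * (a * b) <= s + e * (k.+1 * k) ->
   k.+1 * (p + q) <= 2 * s + 2 * (k * k) * e)%N.
Proof.
move=> ab b1 ba pq h; have kab : (k <= a * b)%N by nia.
have : (k.+1 * (p + q) <= 2 * (a * q + b * p))%N by rewrite -ab; nia.
by have : (e * k <= e * (a * b))%N by [rewrite leq_mul2l kab orbT]; nia.
Qed.

Section Reachability.
Variables (R : realFieldType) (k : nat) (H : kgraph k) (e : nat) (beta : R).
Local Notation V := (vert H).
Local Notation n := #|V|.
Hypothesis hk : (4 <= k)%N.
Hypothesis hbad : forall T : {set V}, #|T| = k.-1 -> (#|bad T| <= e)%N.
Hypothesis beta_gt0 : 0 < beta.
(* Equivalently, e stays below (k+1) n / (2 k^2) by a linear amount. *)
Hypothesis he : 2 * k%:R ^+ 2 * e%:R + beta * n%:R <= k.+1%:R * n%:R :> R.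
(* Degenerate tuples of length at most k + 1 then have small probability. *)
Hypothesis hn : (2 * k * k.+1 * 1024 ^ k <= n)%N.
Implicit Types (P Q S T K : {set V}) (x y z v w : V) (s t r : seq V).

Let n_big : (2 * k * k.+1 <= n)%N.
Proof. by apply: leq_trans hn; rewrite leq_pmulr // expn_gt0. Qed.

Let V_gt0 : (0 < n)%N. Proof. by apply: leq_trans n_big; nia. Qed.
Let nR_gt0 : 0 < n%:R :> R. Proof. by rewrite ltr0n. Qed.
Let nR_neq0 : n%:R != 0 :> R. Proof. by rewrite lt0r_neq0. Qed.

(** Since (k+1) / (2 k) <= 5/8 for k >= 4, the k e vertices that may fail to
extend an edge to a clique are fewer than two thirds of all vertices. *)
Lemma card_nonextensions : (8 * (k * e) <= 5 * n)%N.
Proof.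
have : (2 * (k * k) * e <= k.+1 * n)%N.
  rewrite -(ler_nat R) !natrM -expr2.
  by apply: le_trans he; rewrite lerDl mulr_ge0 // ltW.
by move=> h; rewrite -(@leq_pmul2l k) ?(leq_trans _ hk) //; nia.
Qed.

Lemma card_nonnbrs : (32 * e <= 5 * n)%N.
Proof. by apply: leq_trans card_nonextensions; rewrite mulnA leq_mul2r; lia. Qed.

Lemma ext_card S : S \in edges H -> (n <= #|ext S| + k * e)%N.
Proof.
move=> SE; have := ext_bound [set: V] (leq_trans (isT : 1 < 4)%N hk) SE.
rewrite cardsT setIT; move/leq_trans; apply; rewrite leq_add2l.
rewrite -[X in (_ <= X * _)%N](edges_uniform SE) -sum_nat_const leq_sum // => u uS.
rewrite setIT hbad //; have := cardsD1 u S.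
by rewrite uS (edges_uniform SE); lia.
Qed.

(** Indicator that s forms a clique with x and also with y. *)
Definition colink x y s : R := (clique_seq (x :: s) && clique_seq (y :: s))%:R.

Lemma colink_ge0 x y s : 0 <= colink x y s. Proof. exact: ler0n. Qed.

(** Draw k - 2 vertices and then one that forms an edge with each of x, y, z and
the drawn ones. Each of the three edges extends to a clique by at least 3n/8
vertices, and three such sets cannot be pairwise disjoint. *)
Lemma colink_ternary x y z :
  1 / 32 <= mean k (fun s => colink x y s + colink y z s + colink x z s).
Proof.
set F := fun s => _; pose m := k.-2.
have F0 s : 0 <= F s by rewrite !addr_ge0 ?colink_ge0.
have km : k = (m + 2)%N by rewrite /m; lia.
rewrite [X in mean X]km mean_cat.
pose ok r := uniq r && ~~ has (mem [:: x; y; z]) r.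
have okF r : size r = m -> ok r -> 1 / 16 <= mean 2 (fun u => F (r ++ u)).
  move=> sr /andP[ur hr].
  have cxr a : a \in [:: x; y; z] -> #|[set v in a :: r]| = k.-1.
    move=> ha; rewrite cardsE (card_uniqP _) /= ?sr; first by rewrite /m; lia.
    by rewrite ur andbT; apply: contra hr => ar; apply/hasP; exists a.
  (* The admissible choices of the next vertex w. *)
  pose W := ~: (bad [set v in x :: r] :|: bad [set v in y :: r] :|: bad [set v in z :: r]).
  have cW : (17 * n <= 32 * #|W|)%N.
    have := cardsC W; rewrite /W setCK.
    set A := bad _; set B := bad _; set C := bad _.
    have := (leq_card_setU (A :|: B) C).1; have := (leq_card_setU A B).1.
    have : (#|A| <= e)%N by apply/hbad/cxr; rewrite !inE eqxx.
    have : (#|B| <= e)%N by apply/hbad/cxr; rewrite !inE eqxx ?orbT.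
    have : (#|C| <= e)%N by apply/hbad/cxr; rewrite !inE eqxx ?orbT.
    have := card_nonnbrs; lia.
  have step w : w \in W -> 1 / 8 <= avg (fun v => F (r ++ [:: w; v])).
    rewrite !inE !negb_or !negbK => /andP[/andP[ex ey] ez].
    pose X a := ext [set v in a :: rcons r w].
    have Xn a : w |: [set v in a :: r] \in edges H -> (n <= #|X a| + k * e)%N.
      have <- : [set v in a :: rcons r w] = w |: [set v in a :: r].
        by apply/setP => v; rewrite !inE mem_rcons inE orbCA.
      exact: ext_card.
    have Xl a v : v \in X a -> clique_seq (a :: r ++ [:: w; v]).
      rewrite inE => /andP[_]; rewrite /clique_seq.
      have -> : [set u in a :: r ++ [:: w; v]] = v |: [set u in a :: rcons r w] => //.
      apply/setP => u; rewrite !inE mem_rcons mem_cat !inE.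
      by case: (u == v); case: (u == w); rewrite ?orbT ?orbF.
    have h3 := card3_le (X x) (X y) (X z).
    have hx := Xn x ex; have hy := Xn y ey; have hz := Xn z ez.
    have hF v : (v \in X x :&: X y)%:R + (v \in X y :&: X z)%:R
       + (v \in X x :&: X z)%:R <= F (r ++ [:: w; v]).
      rewrite /F /colink -!natrD ler_nat !in_setI.
      exact: pairs_le (Xl x v) (Xl y v) (Xl z v).
    apply: le_trans (avg_le hF); rewrite !avgD !avg_mem -!mulrDl -!natrD.
    rewrite ler_pdivlMr // mul1r ler_pdivrMl // -natrM ler_nat.
    by move: h3 hx hy hz card_nonextensions; clear; lia.
  apply: (@le_trans _ _ (1 / 8 * (#|W|%:R / n%:R))); last first.
    by apply: avg_mem_ge => [|v|]; [lra|apply: avg_ge0|].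
  rewrite mulrA ler_pdivlMr // -(ler_pM2l (ltr0n _ 256)) mulrA.
  have -> : 256%:R * (1 / 16) = 16%:R :> R by field.
  have -> : 256%:R * (1 / 8 * #|W|%:R) = 32%:R * #|W|%:R :> R by field.
  by rewrite -!natrM ler_nat; lia.
have := mean_collision R V_gt0 m [:: x; y; z].
set C := mean m _ => hC.
apply: (@le_trans _ _ (1 / 16 * (1 - C))).
  have : C <= 1 / 2.
    apply: le_trans hC _; rewrite ler_pdivrMr // -natrM.
    rewrite mulrC mulrA mulr1 ler_pdivlMr // -natrM ler_nat.
    by apply: leq_trans n_big; move: km => /=; clear; clearbody m; nia.
  lra.
set c := fun t => _ in C hC *.
have -> : 1 / 16 * (1 - C) = mean m (fun t => 1 / 16 + - (1 / 16) * c t).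
  by rewrite meanD mean_const // meanZ -/C; ring.
apply: mean_le => r sr; case: (boolP (ok r)) => [okr|].
  apply: le_trans (okF r sr okr); rewrite gerDl mulNr oppr_le0 mulr_ge0 //; lra.
rewrite negb_and negbK /c => ->; rewrite mulr1 subrr.
by apply: avg_ge0 => v; apply: avg_ge0 => w; apply: F0.
Qed.

(** The constant is below a third of the bound 1/32 of [colink_ternary], and it is
half of the bound 1/256 for the mean over y that the proof of [nbrs_card] finds. *)
Definition adj x y := 1 / 512 <= mean k (colink x y).

Lemma colink_sym x y s : colink x y s = colink y x s. Proof. by rewrite /colink andbC. Qed.

Lemma adj_sym x y : adj x y = adj y x.
Proof. by congr (_ <= _); apply: eq_mean => s _; apply: colink_sym. Qed.

Lemma adj_ternary x y z : adj x y || adj y z || adj x z.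
Proof.
have := colink_ternary x y z; rewrite !meanD.
by apply: contraTT; rewrite /adj !negb_or -!ltNge; lra.
Qed.

Lemma mean_clique_seq x : 1 / 96 <= mean k (fun s => (clique_seq (x :: s))%:R) :> R.
Proof.
have := colink_ternary x x x; rewrite !meanD.
have -> : mean k (colink x x) = mean k (fun s => (clique_seq (x :: s))%:R).
  by apply: eq_mean => s _; rewrite /colink andbb.
by lra.
Qed.

Definition nbrs x := [set y | adj x y].

Lemma ext_cardR S : S \in edges H -> 3 / 8 <= #|ext S|%:R / n%:R :> R.
Proof.
move=> SE; rewrite ler_pdivlMr // mulrAC ler_pdivrMr // mulrC -!natrM ler_nat.
by have := ext_card SE; have := card_nonextensions; lia.
Qed.

(** Every clique x s can exchange x for at least 3n/8 vertices y; pairs x, y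
that are not adjacent account for too little of this. *)
Lemma nbrs_card x : 1 / 512 <= #|nbrs x|%:R / n%:R :> R.
Proof.
have low : 1 / 256 <= mean k (fun s => avg (fun y => colink x y s)).
  apply: (@le_trans _ _ (3 / 8 * (1 / 96))); first by lra.
  apply: le_trans (ler_wpM2l _ (mean_clique_seq x)) _; first by lra.
  rewrite -meanZ; apply: mean_le => s ss.
  case: (boolP (clique_seq (x :: s))) => [cx|_]; last first.
    by rewrite mulr0 avg_ge0 // => v; rewrite colink_ge0.
  have sE := clique_seq_edge ss cx; rewrite mulr1.
  apply: le_trans (ext_cardR sE) _; rewrite -avg_mem; apply: avg_le => y.
  by rewrite ler_nat; case: (boolP (y \in _)) => // /ext_clique_seq ->; rewrite cx.
rewrite -avg_mean_swap in low.
suff : avg (fun y => mean k (colink x y)) <= #|nbrs x|%:R / n%:R + 1 / 512 by lra.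
rewrite -avg_mem -[X in _ + X](avg_const V_gt0) -avgD; apply: avg_le => y.
rewrite inE /adj; case: (leP (1 / 512) _) => [_|/ltW]; last by rewrite add0r.
have : mean k (colink x y) <= mean k (fun _ : seq V => 1).
  by apply: mean_le => s _; rewrite lern1 leq_b1.
by rewrite mean_const // mulr1n; lra.
Qed.

(** The number of vertices lying on the side opposite to v that can replace v in
the clique K. *)
Definition oppext P Q K v : nat :=
  (v \in P) * #|ext (K :\ v) :&: Q| + (v \in Q) * #|ext (K :\ v) :&: P|.

Lemma sum_mem (K P : {set V}) : (\sum_(v in K) (v \in P) = #|K :&: P|)%N.
Proof.
rewrite -sum1_card big_mkcond [RHS]big_mkcond /=; apply: eq_bigr => v _.
by rewrite inE; case: (v \in K); case: (v \in P).
Qed.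

Lemma sum_pairs_swap K (G : V -> V -> nat) :
  (\sum_(v in K) \sum_(u in K :\ v) G v u = \sum_(v in K) \sum_(u in K :\ v) G u v)%N.
Proof.
rewrite (exchange_big_dep (mem K)) /=; last by move=> v u _; rewrite inE => /andP[].
apply: eq_bigr => u uK; apply: eq_bigl => v.
by rewrite !inE uK andbT andbC eq_sym.
Qed.

(** By [ext_bound] the left member loses at most the sum, over ordered pairs v, u
of K, of the vertices opposite to v that are bad for K without u and v. This bad
set has at most e elements and is the same for both orders. If u and v lie on the
same side, the two orders lose at most 2 e together; if they lie on opposite
sides, one order only loses vertices of P and the other only vertices of Q, hence
at most e together, which saves e for each of the #|K :&: P| * #|K :&: Q| pairs on
opposite sides. *)
Lemma opposite_ext_bound K P Q : clique K -> [disjoint P & Q] ->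
  (#|K :&: P| * #|Q| + #|K :&: Q| * #|P| + e * (#|K :&: P| * #|K :&: Q|)
     <= \sum_(v in K) oppext P Q K v + e * (k.+1 * k))%N.
Proof.
move=> cK dPQ; have k1 : (1 < k)%N by lia.
pose b v u := bad (K :\ v :\ u).
pose g v u := ((v \in P) * #|b v u :&: Q| + (v \in Q) * #|b v u :&: P|)%N.
pose G v u := (g v u + e * ((v \in P) * (u \in Q)))%N.
have GG v u : v \in K -> u \in K :\ v -> (G v u + G u v <= 2 * e)%N.
  move=> vK; rewrite inE => /andP[/[!inE] uv uK].
  have cb : (#|b v u| <= e)%N.
    apply: hbad; have := cardsD1 u (K :\ v); have := cardsD1 v K.
    by rewrite !inE uK vK uv (clique_card cK) /=; clear; lia.
  have bC : b u v = b v u.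
    by rewrite /b; congr bad; apply/setP => w; rewrite !inE andbCA.
  have bPQ : (#|b v u :&: P| + #|b v u :&: Q| <= e)%N.
    apply: leq_trans cb; rewrite -(cardsID P (b v u)) leq_add2l subset_leq_card //.
    apply/subsetP => w; rewrite !inE => /andP[-> wQ].
    by rewrite (disjointFl dPQ).
  have dis w : (w \in P) && (w \in Q) = false.
    by apply/negP => /andP[wP]; rewrite (disjointFr dPQ wP).
  rewrite /G /g bC; move: (dis v) (dis u) bPQ; move: #|_| #|_| => p q; clear.
  by do 4! case: (_ \in _) => //=; lia.
have sumG : (\sum_(v in K) \sum_(u in K :\ v) G v u <= e * (k.+1 * k))%N.
  rewrite -(@leq_pmul2l 2) // mul2n -addnn {1}sum_pairs_swap -big_split /=.
  apply: (@leq_trans (\sum_(v in K) \sum_(u in K :\ v) 2 * e)%N).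
    apply: leq_sum => v vK; rewrite -big_split /=.
    by apply: leq_sum => u uK; rewrite addnC GG.
  apply: (@leq_trans (\sum_(v in K) k * (2 * e))%N); last first.
    by rewrite sum_nat_const (clique_card cK); lia.
  apply: leq_sum => v vK; rewrite sum_nat_const leq_mul2r.
  suff -> : #|K :\ v| = k by rewrite leqnn orbT.
  by have := cardsD1 v K; rewrite vK (clique_card cK); lia.
have sumPQ : (\sum_(v in K) \sum_(u in K :\ v) (v \in P) * (u \in Q)
                = #|K :&: P| * #|K :&: Q|)%N.
  rewrite -!sum_mem big_distrl /=; apply: eq_bigr => v vK.
  rewrite big_distrr (big_setD1 v vK) /=.
  have -> : ((v \in P) * (v \in Q) = 0)%N; last by [].
  by case: (boolP (v \in P)) => // vP; rewrite (disjointFr dPQ vP).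
have main v : v \in K -> ((v \in P) * #|Q| + (v \in Q) * #|P|
     <= oppext P Q K v + \sum_(u in K :\ v) g v u)%N.
  move=> vK; have KvE := clique_edge cK vK.
  have hQ := ext_bound Q k1 KvE; have hP := ext_bound P k1 KvE.
  rewrite /g /b big_split /= -!big_distrr /= /oppext.
  move: hP hQ; clear; case: (v \in P); case: (v \in Q); rewrite ?mul0n ?mul1n; lia.
have : (\sum_(v in K) ((v \in P) * #|Q| + (v \in Q) * #|P|)
     <= \sum_(v in K) (oppext P Q K v + \sum_(u in K :\ v) g v u))%N by exact: leq_sum.
rewrite !big_split /= -!big_distrl /= !sum_mem => h.
have -> : (#|K :&: P| * #|K :&: Q| = \sum_(v in K) \sum_(u in K :\ v) (v \in P) * (u \in Q))%N.
  by [].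
apply: leq_trans (leq_add (leqnn _) sumG).
apply: leq_trans (leq_add h (leqnn _)) _.
rewrite -addnA leq_add2l big_distrr -big_split /=; apply: leq_sum => v vK.
by rewrite big_distrr -big_split.
Qed.

Section TwoSides.
Variables (P Q : {set V}).
Hypothesis dPQ : [disjoint P & Q].
Hypothesis lePQ : (#|P| <= #|Q|)%N.

Definition share s (A : {set V}) : R := #|ext [set v in s] :&: A|%:R / n%:R.

(** The probability that a random triple p, q, s has p in P, q in Q, and s
forming a clique with each of p and q. *)
Definition cross : R := mean k (fun s => share s P * share s Q).

(** For a clique formed by v and s, the proportion of vertices opposite to v that
can replace v. *)
Definition flip v s : R := (v \in ext [set v in s])%:R *
  ((v \in P)%:R * share s Q + (v \in Q)%:R * share s P).

Definition rem_nth i s := take i s ++ drop i.+1 s.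

Definition flips v0 t : R := \sum_(i < k.+1) flip (nth v0 t i) (rem_nth i t).

Lemma share_ge0 s (A : {set V}) : 0 <= share s A.
Proof. by rewrite divr_ge0. Qed.

Lemma flips_ge0 v0 t : 0 <= flips v0 t.
Proof.
by apply: sumr_ge0 => i _; rewrite mulr_ge0 // addr_ge0 // mulr_ge0 // share_ge0.
Qed.

Lemma avg_flip s : avg (fun v => flip v s) = 2 * (share s P * share s Q).
Proof.
have inI (A : {set V}) : avg (fun v => (v \in ext [set v in s])%:R * (v \in A)%:R) = share s A.
  by rewrite /share -avg_mem; apply: eq_avg => v; rewrite in_setI -natrM mulnb.
rewrite (@eq_avg _ _ _ (fun v =>
    share s Q * ((v \in ext [set v in s])%:R * (v \in P)%:R) +
    share s P * ((v \in ext [set v in s])%:R * (v \in Q)%:R))) => [|v].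
  by rewrite avgD !avgZ !inI; ring.
by rewrite /flip; ring.
Qed.

(** Drawing the i-th entry last turns each summand into a choice of s and of two
vertices on opposite sides, counted once for either order. *)
Lemma mean_flips v0 : mean k.+1 (flips v0) = 2 * k.+1%:R * cross.
Proof.
rewrite mean_sum (eq_bigr (fun=> 2 * cross)) => [|i _].
  by rewrite sumr_const card_ord -[_ *+ _]mulr_natl; ring.
rewrite (mean_insert _ (leq_ord i)) /cross -meanZ; apply: eq_mean => s ss.
rewrite -avg_flip; apply: eq_avg => v.
have si : size (take i s) = i by rewrite size_takel // ss -ltnS.
rewrite nth_cat si ltnn subnn /rem_nth take_size_cat //.
by rewrite -cat_rcons drop_size_cat ?size_rcons ?si // cat_take_drop.
Qed.

Lemma flips_clique v0 t : size t = k.+1 -> clique_seq t ->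
  flips v0 t = (\sum_(v in [set v in t]) oppext P Q [set v in t] v)%:R / n%:R.
Proof.
move=> st ct; have ut := clique_seq_uniq st ct.
rewrite natr_sum mulr_suml (eq_bigl (mem t)) => [|v]; last by rewrite inE.
rewrite -(big_uniq _ ut) (big_nth v0) big_mkord st /=; apply: eq_bigr => i _.
have it : (i < size t)%N by rewrite st.
have tE : t = take i t ++ nth v0 t i :: drop i.+1 t.
  by rewrite -drop_nth // cat_take_drop.
set v := nth v0 t i in tE *.
have remE : [set u in rem_nth i t] = [set u in t] :\ v.
  apply/setP => u; rewrite /rem_nth !inE {3}tE !mem_cat inE.
  move: ut; rewrite {1}tE cat_uniq /= negb_or => /and3P[_ /andP[vt _] /andP[vd _]].
  by case: (eqVneq u v) => // ->; rewrite (negPf vt) (negPf vd).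
have vt : v \in t by apply: mem_nth.
have vext : v \in ext ([set u in t] :\ v).
  by rewrite !inE eqxx /= setD1K // inE.
rewrite /flip remE vext mul1r /share remE /oppext natrD !natrM.
by field.
Qed.

Variable theta : R.
Hypothesis theta_small : theta <= 1 / 1024.
Hypothesis theta_beta : 2 * k.+1%:R * theta <= beta.
Hypothesis cP : 1 / 1024 <= #|P|%:R / n%:R :> R.
Hypothesis cPQ : (1 - theta) * n%:R <= #|P|%:R + #|Q|%:R :> R.

Lemma flips_lower v0 t : size t = k.+1 -> clique_seq t ->
  (#|[set v in t] :&: P| + #|[set v in t] :&: Q| = k.+1)%N ->
  (1 <= #|[set v in t] :&: Q| <= #|[set v in t] :&: P|)%N ->
  beta / 4 <= flips v0 t.
Proof.
move=> st ct; rewrite flips_clique //.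
have := opposite_ext_bound ct dPQ.
set K := [set v in t]; set a := #|K :&: P|; set b := #|K :&: Q|.
set s := (\sum_(v in K) _)%N => h ab /andP[b1 ba].
have hs : (k.+1 * (#|P| + #|Q|) <= 2 * s + 2 * (k * k) * e)%N.
  exact: opposite_arith ab b1 ba lePQ h.
rewrite ler_pdivlMr //.
have : k.+1%:R * (#|P|%:R + #|Q|%:R) <= 2 * s%:R + 2 * k%:R ^+ 2 * e%:R :> R.
  by rewrite -natrD expr2 -!natrM -natrD ler_nat.
have : k.+1%:R * ((1 - theta) * n%:R) <= k.+1%:R * (#|P|%:R + #|Q|%:R) :> R.
  by rewrite ler_wpM2l.
have : 2 * k.+1%:R * theta * n%:R <= beta * n%:R by rewrite ler_wpM2r.
move: he; lra.
Qed.

Lemma card_memI t (A : {set V}) : uniq t -> #|[set v in t] :&: A| = count (mem A) t.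
Proof.
move=> ut; rewrite -size_filter -(card_uniqP (filter_uniq _ ut)).
by apply: eq_card => v; rewrite !inE mem_filter andbC.
Qed.

(** By [mean_flips] it suffices to find a dense set of cliques with many opposite
replacements. Choose k - 1 vertices in P, then one in Q that completes an edge,
and then any vertex of P or Q that completes a clique: such a clique has at least
as many vertices in P as in Q, and at least one in Q, as [flips_lower] asks. *)
Lemma cross_lower : beta / k.+1%:R * (1 / 1024) ^+ k <= cross.
Proof.
have [v0 _] := card_gt0P V_gt0.
suff : (1 / 32) * (1 / 1024) ^+ k.-1 * (beta / 4) <= mean k.+1 (flips v0).
  rewrite mean_flips.
  have -> : (1 / 1024) ^+ k = (1 / 1024) * (1 / 1024) ^+ k.-1 :> R.
    by rewrite -exprS prednK // (leq_trans _ hk).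
  have : 0 <= (1 / 1024) ^+ k.-1 * beta by rewrite mulr_ge0 ?exprn_ge0 ?ltW //; lra.
  move: (_ ^+ _) => a; rewrite [X in X <= cross]mulrAC ler_pdivrMr ?ltr0n //; lra.
have kk : k.+1 = (k.-1 + 2)%N by clear -hk; lia.
rewrite [X in mean X]kk mean_cat.
have cQ : (n <= 4 * (#|Q| - e))%N.
  suff : (49 * n <= 100 * #|Q|)%N by have := card_nonnbrs; clear; lia.
  rewrite -(ler_nat R) !natrM; have : #|P|%:R <= #|Q|%:R :> R by rewrite ler_nat.
  have : theta * n%:R <= 1 / 1024 * n%:R by rewrite ler_wpM2r.
  move: (nR_gt0) cPQ; lra.
have step r : size r = k.-1 -> all (mem P) r && uniq r ->
    (1 / 16) * (beta / 4) <= mean 2 (fun u => flips v0 (r ++ u)).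
  move=> sr /andP[rP ur].
  pose W := Q :\: bad [set v in r].
  have cW : 1 / 4 <= #|W|%:R / n%:R :> R.
    rewrite ler_pdivlMr // mulrAC mul1r ler_pdivrMr // -natrM ler_nat mulnC.
    apply: leq_trans cQ _; rewrite leq_mul2l /W cardsD leq_sub2l //.
    apply: leq_trans (subset_leq_card (subsetIr _ _)) _; apply: hbad.
    by rewrite cardsE (card_uniqP ur).
  apply: (@le_trans _ _ (1 / 4 * (beta / 4) * (#|W|%:R / n%:R))).
    apply: (le_trans _ (ler_wpM2l _ cW)); move: (beta_gt0); lra.
  apply: avg_mem_ge => [|w|w]; first by move: (beta_gt0); lra.
    by apply: avg_ge0 => v; apply: flips_ge0.
  rewrite inE => /andP[wbad wQ].
  pose X := ext [set v in rcons r w] :&: (P :|: Q).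
  have rwE : [set v in rcons r w] \in edges H.
    have -> : [set v in rcons r w] = w |: [set v in r].
      by apply/setP => v; rewrite !inE mem_rcons inE.
    by move: wbad; rewrite inE negbK.
  have cX : 1 / 4 <= #|X|%:R / n%:R :> R.
    have := ext_cardR rwE; set E := ext _ in X *.
    have : (#|E| + (#|P| + #|Q|) <= n + #|X|)%N.
      have -> : (#|P| + #|Q| = #|P :|: Q|)%N by rewrite cardsU disjoint_setI0 // cards0 subn0.
      by rewrite -cardsUI leq_add2r max_card.
    rewrite !ler_pdivlMr // -(ler_nat R) !natrD.
    have : theta * n%:R <= 1 / 1024 * n%:R by rewrite ler_wpM2r.
    move: (nR_gt0) cPQ; lra.
  apply: (@le_trans _ _ (beta / 4 * (#|X|%:R / n%:R))).
    apply: (le_trans _ (ler_wpM2l _ cX)); move: (beta_gt0); lra.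
  apply: avg_mem_ge => [|v|v]; first by move: (beta_gt0); lra.
    exact: flips_ge0.
  rewrite in_setI => /andP[vext vPQ].
  have sz : size (r ++ [:: w; v]) = k.+1 by rewrite size_cat sr -kk.
  have ct : clique_seq (r ++ [:: w; v]).
    have := ext_clique_seq vext; rewrite /clique_seq; congr (clique _); apply/setP => u.
    by rewrite !inE mem_rcons mem_cat !inE; case: (u == v); case: (u == w); rewrite ?orbT ?orbF.
  have ut := clique_seq_uniq sz ct.
  have wP : w \in P = false by rewrite (disjointFl dPQ).
  have cr : count (mem P) r = k.-1 by move: rP; rewrite all_count sr => /eqP.
  have crQ : count (mem Q) r = 0%N.
    apply/eqP; rewrite -leqn0 leqNgt -has_count; apply/hasP => -[u /(allP rP) /= uP /= uQ].
    by have := disjointFr dPQ uP; rewrite uQ.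
  have vx : ((v \in P) + (v \in Q) = 1)%N.
    move: vPQ; rewrite inE => /orP[vP|vQ].
      by rewrite vP (disjointFr dPQ vP).
    by rewrite vQ (disjointFl dPQ vQ).
  have [cntP cntQ] : #|[set u in r ++ [:: w; v]] :&: P| = (k.-1 + (v \in P))%N /\
     #|[set u in r ++ [:: w; v]] :&: Q| = (1 + (v \in Q))%N.
    by rewrite !card_memI // !count_cat cr crQ /= wP wQ !addn0.
  apply: flips_lower => //; rewrite cntP cntQ; move: vx hk; clear; lia.
apply: (@le_trans _ _ (mean k.-1 (fun r =>
   (1 / 16) * (beta / 4) * (all (mem P) r && uniq r)%:R))).
  rewrite meanZ.
  suff : 1 / 2 * (1 / 1024) ^+ k.-1 <= mean k.-1 (fun r => (all (mem P) r && uniq r)%:R : R).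
    move: beta_gt0; set a := _ ^+ _; set b := mean _ _; nra.
  have hC := mean_collision R V_gt0 k.-1 (@nil V).
  have hA := mean_all R k.-1 P.
  have : (1 / 1024) ^+ k.-1 <= (#|P|%:R / n%:R) ^+ k.-1 :> R.
    by apply: lerXn2r => //; rewrite nnegrE ?divr_ge0.
  have : mean k.-1 (fun r => (all (mem P) r)%:R) <=
     mean k.-1 (fun r => (all (mem P) r && uniq r)%:R)
     + mean k.-1 (fun r => (~~ uniq r || has (mem (@nil V)) r)%:R) :> R.
    rewrite -meanD; apply: mean_le => r _; rewrite -natrD ler_nat.
    by case: (all _ r); case: (uniq r).
  have : k.-1%:R * k.-1%:R / n%:R <= 1 / 2 * (1 / 1024) ^+ k.-1 :> R.
    rewrite ler_pdivrMr // -natrM.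
    have hA' : (2 * (k.-1 * k.-1) * 1024 ^ k.-1 <= n)%N.
      apply: leq_trans hn; apply: leq_mul; last by rewrite leq_pexp2l ?leq_pred.
      by rewrite mulnA !leq_mul ?leq_pred // ltnW // ltnS leq_pred.
    rewrite expr_div_n expr1n !div1r -natrX mulrAC ler_pdivlMr ?ltr0n ?expn_gt0 //.
    by move: hA'; rewrite -(ler_nat R) !natrM; lra.
  move: hC; rewrite hA /= addn0; lra.
apply: mean_le => r sr; case: (boolP (_ && _)) => [h|_].
  by rewrite mulr1; apply: step.
rewrite mulr0; apply: avg_ge0 => v; apply: avg_ge0 => w; apply: flips_ge0.
Qed.

End TwoSides.

Definition link_size := (k + (1 + (k + (1 + k))))%N.

(** Expectation over the parts of a random [join]. *)
Definition means (F : seq V -> V -> seq V -> V -> seq V -> R) : R :=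
  mean k (fun s1 => avg (fun p => mean k (fun s => avg (fun q =>
    mean k (fun s2 => F s1 p s q s2))))).

Lemma mean_join (F : seq V -> R) :
  mean link_size F = means (fun s1 p s q s2 => F (join s1 p s q s2)).
Proof.
rewrite /link_size mean_cat; apply: eq_mean => s1 _.
apply: eq_avg => p; rewrite -/(mean _ _) mean_cat.
by [].
Qed.

Lemma means_le F G :
  (forall s1 p s q s2, size s1 = k -> size s = k -> size s2 = k ->
     F s1 p s q s2 <= G s1 p s q s2) -> means F <= means G.
Proof.
move=> FG; apply: mean_le => s1 z1; apply: avg_le => p.
apply: mean_le => s z; apply: avg_le => q.
by apply: mean_le => s2 z2; apply: FG.
Qed.

Lemma meanZr m (F : seq V -> R) (c : R) : mean m (fun t => F t * c) = mean m F * c.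
Proof. by rewrite mulrC -meanZ; apply: eq_mean => t _; rewrite mulrC. Qed.

Lemma means_prod (a : V -> seq V -> R) (b : V -> V -> seq V -> R) (c : V -> seq V -> R) :
  means (fun s1 p s q s2 => a p s1 * b p q s * c q s2)
   = avg (fun p => avg (fun q => mean k (a p) * mean k (b p q) * mean k (c q))).
Proof.
rewrite /means -avg_mean_swap; apply: eq_avg => p.
transitivity (mean k (fun s1 => avg (fun q => a p s1 * mean k (b p q) * mean k (c q)))).
  apply: eq_mean => s1 _; rewrite -avg_mean_swap; apply: eq_avg => q.
  rewrite -[X in _ = X * _]meanZ -meanZr; apply: eq_mean => s _.
  by rewrite meanZ.
by rewrite -avg_mean_swap; apply: eq_avg => q; rewrite -!meanZr.
Qed.

Variable theta : R.
Hypothesis theta_gt0 : 0 < theta.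
Hypothesis theta_small : theta <= 1 / 1024.
Hypothesis theta_beta : 2 * k.+1%:R * theta <= beta.
Let kappa := theta * (beta / k.+1%:R * (1 / 1024) ^+ k) / 1024 ^+ 3.
Hypothesis hn2 : 2 * (link_size * (link_size + 2))%:R <= kappa * n%:R.

Lemma beta_le : beta / k.+1%:R <= 1.
Proof.
rewrite ler_pdivrMr ?ltr0n // mul1r -(ler_pM2r nR_gt0); apply: le_trans he.
by rewrite lerDr !mulr_ge0 ?exprn_ge0.
Qed.

(** The three factors describe the three blocks of a join that links x and y.
Given p and q the blocks are independent, which is why the hypothesis may be
stated with a product of means; joins with repeated vertices are discarded at the
cost of half the bound. *)
Lemma mean_linked_lower x y (a : V -> seq V -> R) b c :
  (forall s1 p s q s2, let t := join s1 p s q s2 in uniq (x :: t) -> uniq (y :: t) ->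
     a p s1 * b p q s * c q s2 <= (linked x y t)%:R) ->
  (forall s1 p s q s2, a p s1 * b p q s * c q s2 <= 1) ->
  kappa <= avg (fun p => avg (fun q => mean k (a p) * mean k (b p q) * mean k (c q))) ->
  kappa / 2 <= mean link_size (fun t => (linked x y t)%:R).
Proof.
move=> hlink h1; rewrite -means_prod => hlow.
have hC := mean_collision R V_gt0 link_size [:: x; y].
have hC2 : link_size%:R * (link_size + size [:: x; y])%:R / n%:R <= kappa / 2.
  rewrite ler_pdivrMr //; move: hn2; rewrite natrM /=; lra.
have : means (fun s1 p s q s2 => a p s1 * b p q s * c q s2) <=
   mean link_size (fun t => (linked x y t)%:R + (~~ uniq t || has (mem [:: x; y]) t)%:R).
  rewrite mean_join; apply: means_le => s1 p s q s2 _ _ _.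
  set t := join _ _ _ _ _.
  case: (boolP (uniq t)) => ut /=; last by rewrite (le_trans (h1 _ _ _ _ _)) // lerDr.
  case: (boolP (has _ t)) => /= ht; first by rewrite (le_trans (h1 _ _ _ _ _)) // lerDr.
  rewrite addr0; have nt z : z \in [:: x; y] -> z \notin t.
    by move=> hz; apply: contra ht => zt; apply/hasP; exists z.
  by apply: hlink; rewrite /= ut nt // !inE eqxx ?orbT.
rewrite meanD; lra.
Qed.

Let X := beta / k.+1%:R * (1 / 1024) ^+ k.

Let X_ge0 : 0 <= X.
Proof. by rewrite !mulr_ge0 ?exprn_ge0 ?invr_ge0 ?ltW //; lra. Qed.

Let X_le1 : X <= 1.
Proof.
have h : (1 / 1024) ^+ k <= 1 :> R by apply: exprn_ile1; lra.
apply: le_trans beta_le; rewrite ler_piMr // divr_ge0 // ltW //.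
Qed.

Let kappaE : kappa = theta * X / 1024 ^+ 3. Proof. by []. Qed.

Lemma avg2_ge (c : R) (F : V -> V -> R) :
  (forall p q, c <= F p q) -> c <= avg (fun p => avg (F p)).
Proof.
move=> cF; rewrite -[c](avg_const V_gt0); apply: avg_le => p.
by rewrite -[c](avg_const V_gt0); apply: avg_le.
Qed.

(** If x and y are adjacent, one block does the exchange and the other two are
arbitrary cliques. If x and y have many common neighbours p, the exchange goes
from x to p and from p to y. Otherwise it goes from x to p, from p to q and from q
to y, where p and q run over the private neighbourhoods of x and y and the middle
step is [cross_lower]. *)
Lemma linked_dense x y : kappa / 2 <= mean link_size (fun t => (linked x y t)%:R).
Proof.
wlog hxy : x y / (#|nbrs x| <= #|nbrs y|)%N.
  move=> W; have /orP[|h] := leq_total #|nbrs x| #|nbrs y|; first exact: W.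
  rewrite (eq_mean (G := fun t => (linked y x t)%:R)) => [|t _]; first exact: W.
  by rewrite linked_sym.
have pos3 : 0 < 1024 ^+ 3 :> R by rewrite exprn_gt0.
have [axy|naxy] := boolP (adj x y).
  apply: (mean_linked_lower (a := fun p s => colink x y s)
    (b := fun p q s => (clique_seq (p :: s))%:R) (c := fun q s => (clique_seq (q :: s))%:R)).
  - move=> s1 p s q s2 t ux uy; rewrite -!natrM !mulnb ler_nat.
    case: (boolP (_ && _)) => // /andP[/andP[/andP[h1 h2] h3] h4].
    by rewrite (linked_join (perm_refl [:: y; p; q]) ux uy) // h1 h2 h3 h4.
  - by move=> s1 p s q s2; rewrite -!natrM !mulnb lern1 leq_b1.
  - apply: avg2_ge => p q; apply: (@le_trans _ _ (1 / 512 * (1 / 96) * (1 / 96))).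
      rewrite kappaE ler_pdivrMr //; move: X_ge0 X_le1 theta_gt0 theta_small; nra.
    have h1 := mean_clique_seq p; have h2 := mean_clique_seq q.
    by apply: ler_pM; [lra|lra| |exact: h2]; apply: ler_pM => //; lra.
pose I := nbrs x :&: nbrs y.
(* The proportion theta separates many from few common neighbours. *)
have [hI|hI] := leP theta (#|I|%:R / n%:R).
  apply: (mean_linked_lower (a := fun p s => colink x p s)
    (b := fun p q s => colink p y s) (c := fun q s => (clique_seq (q :: s))%:R)).
  - move=> s1 p s q s2 t ux uy; rewrite -!natrM !mulnb ler_nat.
    case: (boolP (_ && _)) => // /andP[/andP[/andP[h1 h2] /andP[h3 h4]] h5].
    have ab : perm_eq [:: p; y; q] [:: y; p; q] by rewrite (perm_catCA [:: p] [:: y] [:: q]).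
    by rewrite (linked_join ab ux uy) // h1 h2 h3 h4 h5.
  - by move=> s1 p s q s2; rewrite -!natrM !mulnb lern1 leq_b1.
  - apply: (@le_trans _ _ (1 / 512 * (1 / 512) * (1 / 96) * (#|I|%:R / n%:R))).
      apply: (@le_trans _ _ (1 / 512 * (1 / 512) * (1 / 96) * theta)).
        rewrite kappaE ler_pdivrMr //; move: X_ge0 X_le1 theta_gt0 theta_small; nra.
      by rewrite ler_wpM2l //; lra.
    apply: avg_mem_ge => [|p|p]; first lra.
      by apply: avg_ge0 => q; rewrite !mulr_ge0 // mean_ge0 // => *; apply: ler0n.
    rewrite inE => /andP[px py]; rewrite -[X in X <= _](avg_const V_gt0); apply: avg_le => q.
    apply: ler_pM; [lra|lra| |exact: mean_clique_seq]; apply: ler_pM; [lra|lra| |].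
      by move: px; rewrite inE.
    by move: py; rewrite inE adj_sym.
pose P := nbrs x :\: nbrs y; pose Q := nbrs y :\: nbrs x.
have cIP := cardsID (nbrs y) (nbrs x); have cIQ := cardsID (nbrs x) (nbrs y).
rewrite setIC -/I -/Q in cIQ; rewrite -/I -/P in cIP.
have dPQ : [disjoint P & Q].
  rewrite -setI_eq0; apply/eqP/setP => v; rewrite in_setI !in_setD in_set0.
  by case: (v \in nbrs x); case: (v \in nbrs y).
have hP : 1 / 1024 <= #|P|%:R / n%:R :> R.
  have := nbrs_card x; rewrite -cIP natrD mulrDl; move: hI theta_small; lra.
(* As x and y are not adjacent, every vertex is adjacent to one of them. *)
have hPQ : (1 - theta) * n%:R <= #|P|%:R + #|Q|%:R :> R.
  have : (n <= #|P| + #|Q| + #|I|)%N.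
    have : [set: V] \subset nbrs x :|: nbrs y.
      apply/subsetP => z _; rewrite !inE; have := adj_ternary z x y.
      by rewrite (negPf naxy) orbF adj_sym [adj z y]adj_sym.
    move/subset_leq_card; rewrite cardsT => /leq_trans; apply.
    by rewrite cardsU -/I -cIP -cIQ; clear; lia.
  rewrite -(ler_nat R) !natrD; move: hI; rewrite ltr_pdivrMr //; lra.
have lePQ : (#|P| <= #|Q|)%N by move: hxy cIP cIQ; clear; lia.
have hcross := cross_lower dPQ lePQ theta_small theta_beta hP hPQ.
apply: (mean_linked_lower (a := fun p s => colink x p s)
    (b := fun p q s => colink p q s) (c := fun q s => colink q y s)).
- move=> s1 p s q s2 t ux uy; rewrite -!natrM !mulnb ler_nat.
  case: (boolP (_ && _)) => // /andP[/andP[/andP[h1 h2] /andP[h3 h4]] /andP[h5 h6]].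
  have ab : perm_eq [:: p; q; y] [:: y; p; q] by rewrite (perm_catC [:: p; q] [:: y]).
  by rewrite (linked_join ab ux uy) // h1 h2 h3 h4 h5 h6.
- by move=> s1 p s q s2; rewrite -!natrM !mulnb lern1 leq_b1.
apply: (@le_trans _ _ (1 / 512 * (1 / 512) * cross P Q)).
  rewrite kappaE ler_pdivrMr //; move: X_ge0 hcross theta_gt0 theta_small; rewrite -/X; nra.
rewrite /cross -meanZ.
pose F p q s : R := 1 / 512 * (1 / 512) *
  ((p \in ext [set v in s] :&: P)%:R * (q \in ext [set v in s] :&: Q)%:R).
have -> : mean k (fun t => 1 / 512 * (1 / 512) * (share t P * share t Q))
   = avg (fun p => avg (fun q => mean k (F p q))).
  transitivity (mean k (fun s => avg (fun p => avg (fun q => F p q s)))).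
    apply: eq_mean => s _; rewrite /share -!avg_mem [_ * avg _]mulrC -!avgZ.
    apply: eq_avg => p; rewrite mulrCA mulrC -mulrA -!avgZ; apply: eq_avg => q.
    by rewrite /F; ring.
  rewrite -avg_mean_swap; apply: eq_avg => p.
  by rewrite -avg_mean_swap.
apply: avg_le => p; apply: avg_le => q; rewrite /F meanZ.
have c0 : 0 <= 1 / 512 :> R by lra.
have m0 (z w : V) : 0 <= mean k (colink z w) by apply: mean_ge0 => s _; apply: ler0n.
have [pP|pP] := boolP (p \in P); last first.
  rewrite (eq_mean (G := fun=> 0)) => [|s _]; last by rewrite in_setI (negPf pP) andbF mul0r.
  by rewrite mean_const // mulr0 !mulr_ge0.
have [qQ|qQ] := boolP (q \in Q); last first.
  rewrite (eq_mean (G := fun=> 0)) => [|s _]; last by rewrite !in_setI (negPf qQ) !andbF mulr0.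
  by rewrite mean_const // mulr0 !mulr_ge0.
have xp : 1 / 512 <= mean k (colink x p) by move: pP; rewrite in_setD => /andP[_]; rewrite inE.
have qy : 1 / 512 <= mean k (colink q y).
  by move: qQ; rewrite in_setD => /andP[_]; rewrite inE adj_sym.
rewrite mulrAC; apply: ler_pM => //.
  by rewrite mulr_ge0 // mean_ge0 // => s _; rewrite mulr_ge0.
apply: ler_pM => //; first by rewrite mean_ge0 // => s _; rewrite mulr_ge0.
apply: mean_le => s _; rewrite -natrM mulnb ler_nat !in_setI.
case: (boolP (_ && _)) => // /andP[/andP[pe _] /andP[qe _]].
by rewrite (ext_clique_seq pe) (ext_clique_seq qe).
Qed.

End Reachability.

(** * Absorption *)

Lemma bin_le_expn n m : ('C(n, m) <= n ^ m)%N.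
Proof.
apply: (@leq_trans (n ^_ m)); first by rewrite -bin_ffact leq_pmulr // fact_gt0.
by elim: m => // m IHm; rewrite ffactnSr expnSr leq_mul // leq_subr.
Qed.

Lemma subset_card (T : finType) (A : {set T}) m : (m <= #|A|)%N ->
  exists2 B : {set T}, B \subset A & #|B| = m.
Proof.
move=> mA; exists [set x in take m (enum A)].
  by apply/subsetP => x; rewrite inE => /mem_take; rewrite mem_enum.
by rewrite cardsE (card_uniqP _) ?take_uniq ?enum_uniq // size_takel // -cardE.
Qed.

Section Absorb.
Variables (R : realFieldType) (k : nat) (H : kgraph k) (L : nat) (c : R).
Local Notation V := (vert H).
Local Notation n := #|V|.
Implicit Types (A X Z D : {set V}) (x y z v w : V) (s t u : seq V).
Hypothesis V_gt0 : (0 < n)%N.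
Hypothesis c_gt0 : 0 < c.
Hypothesis link_dense : forall x y, c <= mean L (fun t => (linked x y t)%:R).
Hypothesis clique_seq_dense : c <= mean k.+1 (fun t : seq V => (clique_seq t)%:R).

Let nR_gt0 : 0 < n%:R :> R. Proof. by rewrite ltr0n. Qed.

(** A concatenation of m tuples of length L, linking the vertices of xs to those
of ys one by one. *)
Fixpoint links xs ys t : bool :=
  match xs, ys with
  | x :: xs', y :: ys' => linked x y (take L t) && links xs' ys' (drop L t)
  | _, _ => true
  end.

Lemma links_dense m xs ys : size xs = m -> size ys = m ->
  c ^+ m <= mean (m * L) (fun t => (links xs ys t)%:R).
Proof.
elim: m xs ys => [|m IHm] [|x xs] [|y ys] //= [sx] [sy].
rewrite mulSn.
rewrite (eq_mean (G := fun t => (linked x y (take L t))%:R * (links xs ys (drop L t))%:R)).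
  rewrite (mean_prod _ _ (fun t => (linked x y t)%:R) (fun t => (links xs ys t)%:R)).
  by rewrite exprS; apply: ler_pM; rewrite ?exprn_ge0 ?(ltW c_gt0) // IHm.
by move=> t _; rewrite -natrM mulnb.
Qed.

Lemma links_tileable m xs ys t : size xs = m -> size ys = m -> size t = (m * L)%N ->
  uniq (xs ++ t) -> uniq (ys ++ t) -> links xs ys t ->
  tileable_seq (xs ++ t) /\ tileable_seq (ys ++ t).
Proof.
elim: m xs ys t => [|m IHm] [|x xs] [|y ys] //= t; rewrite ?mul0n ?mulSn.
  by move=> _ _ /size0nil -> _ _ _; split; have := tileable0 H;
    congr (is_true (tileable _)); apply/setP => v; rewrite !inE.
move=> [sx] [sy] st; have tE := cat_take_drop L t.
set t1 := take L t in tE *; set t2 := drop L t in tE *.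
have st2 : size t2 = (m * L)%N by rewrite size_drop st addKn.
have half a (az : seq V) : uniq (a :: az ++ t1 ++ t2) ->
    (uniq (az ++ t2) -> tileable_seq (az ++ t2)) -> tileable_seq (a :: t1) ->
    tileable_seq (a :: az ++ t1 ++ t2).
  move=> ua h1 h2; have pe : perm_eq ((a :: t1) ++ (az ++ t2)) (a :: az ++ t1 ++ t2).
    by rewrite /= perm_cons perm_catCA.
  rewrite -(perm_uniq pe) in ua; rewrite -(eq_tileable_seq (perm_mem pe)).
  apply: tileable_seq_cat => //; apply: h1; move: ua; rewrite cat_uniq.
  by case/and3P.
move=> ux uy /andP[/and4P[_ _ lx ly] hl]; rewrite -tE in ux uy *.
have sub a (az : seq V) : uniq (a :: az ++ t1 ++ t2) -> uniq (az ++ t2).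
  move=> /= /andP[_]; apply: subseq_uniq; rewrite cat_subseq // suffix_subseq //.
have [hx hy] := IHm xs ys t2 sx sy st2 (sub _ _ ux) (sub _ _ uy) hl.
by split; apply: half.
Qed.

Definition absorber_size := (k.+1 + k.+1 * L)%N.

(** A tuple consisting of a clique ys and of links from xs to ys: it is tiled by
ys and the links attached to xs, or, without xs, by the links attached to ys. *)
Definition absorbs xs t := [&& uniq t, ~~ has (mem xs) t, clique_seq (take k.+1 t)
  & links xs (take k.+1 t) (drop k.+1 t)].

Lemma absorbs_tileable xs t : size xs = k.+1 -> uniq xs -> size t = absorber_size ->
  absorbs xs t -> tileable_seq t /\ tileable_seq (xs ++ t).
Proof.
move=> sx ux st /and4P[ut hx]; have tE := cat_take_drop k.+1 t.
set ys := take k.+1 t in tE *; set u := drop k.+1 t in tE * => cys hl.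
rewrite -tE in ut hx *.
have sy : size ys = k.+1 by rewrite size_takel // st leq_addr.
have su : size u = (k.+1 * L)%N by rewrite size_drop st addKn.
have uxt : uniq (xs ++ (ys ++ u)) by rewrite cat_uniq ux hx ut.
have pe : perm_eq (ys ++ (xs ++ u)) (xs ++ (ys ++ u)) by rewrite perm_catCA.
have ux2 : uniq (xs ++ u).
  by move: uxt; rewrite -(perm_uniq pe) [uniq (ys ++ _)]cat_uniq => /and3P[_ _].
have [h1 h2] := links_tileable sx sy su ux2 ut hl; split=> //.
rewrite -(eq_tileable_seq (perm_mem pe)).
apply: tileable_seq_cat => //; last exact: clique_seq_tileable.
by rewrite (perm_uniq pe).
Qed.

Hypothesis n_large :
  2 * (absorber_size * (absorber_size + k.+1))%:R <= c ^+ k.+2 * n%:R.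

Lemma absorbs_dense xs : size xs = k.+1 ->
  c ^+ k.+2 / 2 <= mean absorber_size (fun t => (absorbs xs t)%:R).
Proof.
move=> sx; have hC := mean_collision R V_gt0 absorber_size xs.
have hC2 : absorber_size%:R * (absorber_size + size xs)%:R / n%:R <= c ^+ k.+2 / 2.
  by rewrite ler_pdivrMr // sx; move: n_large; rewrite natrM; lra.
suff : c ^+ k.+2 <= mean absorber_size (fun t => (absorbs xs t)%:R)
   + mean absorber_size (fun t => (~~ uniq t || has (mem xs) t)%:R) by lra.
rewrite -meanD.
apply: (@le_trans _ _ (mean absorber_size (fun t =>
   (clique_seq (take k.+1 t) && links xs (take k.+1 t) (drop k.+1 t))%:R))); last first.
  apply: mean_le => t _; rewrite -natrD ler_nat /absorbs.
  by case: (uniq t); case: (has _ t); case: (clique_seq _); case: (links _ _ _).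
rewrite /absorber_size mean_cat exprS.
apply: (@le_trans _ _ (mean k.+1 (fun t : seq V => (clique_seq t)%:R * c ^+ k.+1))).
  rewrite (eq_mean (G := fun t => c ^+ k.+1 * (clique_seq t)%:R)) => [|t _]; last by rewrite mulrC.
  by rewrite meanZ mulrC ler_wpM2l // exprn_ge0 // ltW.
apply: mean_le => t st.
apply: le_trans (ler_wpM2l (ler0n _ _) (links_dense sx st)) _.
rewrite -meanZ; apply: mean_le => u _.
by rewrite take_size_cat // drop_size_cat // -natrM mulnb.
Qed.

Let d := c ^+ k.+2 / 4.

Let d_le1 : d <= 1.
Proof.
have c1 : c <= 1.
  apply: le_trans clique_seq_dense _; rewrite -[leRHS](mean_const V_gt0 k.+1).
  by apply: mean_le => t _; rewrite lern1 leq_b1.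
have : c ^+ k.+2 <= 1 by rewrite exprn_ile1 // ltW.
by rewrite /d; lra.
Qed.

Definition unabsorbed Z := [set X : {set V} |
  [&& #|X| == k.+1, [disjoint X & Z] & ~~ tileable (Z :|: X)]].

(** Averaging over tuples that avoid D and Z: some tuple absorbs a proportion d
of the sets that Z does not absorb. *)
Lemma absorber_step D Z : tileable Z -> [disjoint Z & D] ->
  absorber_size%:R * (#|D :|: Z|%:R / n%:R) <= d ->
  exists Z', [/\ tileable Z', [disjoint Z' & D], (#|Z'| <= #|Z| + absorber_size)%N
    & #|unabsorbed Z'|%:R <= (1 - d) * #|unabsorbed Z|%:R].
Proof.
move=> tZ dZ small; set U := unabsorbed Z.
have [U0|U_gt0] := posnP #|U|.
  by exists Z; rewrite -/U U0 mulr0 leq_addr.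
pose good X t := absorbs (enum X) t && ~~ has (mem (D :|: Z)) t.
have [t st ht] : exists2 t, size t = absorber_size &
    d * #|U|%:R <= \sum_X ((X \in U) && good X t)%:R.
  apply: (mean_ex V_gt0); rewrite mean_sum.
  rewrite -sum1_card natr_sum mulr_sumr big_mkcond; apply: ler_sum => X _.
  case: (boolP (X \in U)) => [XU|_]; last first.
    by apply: mean_ge0 => t _; apply: ler0n.
  rewrite mulr1.
  have sX : size (enum X) = k.+1.
    by rewrite -cardE; move: XU; rewrite inE => /and3P[/eqP].
  have h1 := absorbs_dense sX.
  have h2 := mean_hit R V_gt0 absorber_size (D :|: Z).
  suff : mean absorber_size (fun t => (absorbs (enum X) t)%:R) <=
     mean absorber_size (fun t => (true && good X t)%:R)
     + mean absorber_size (fun t => (has (mem (D :|: Z)) t)%:R) :> R.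
    move: small h1 h2; rewrite /d; lra.
  rewrite -meanD; apply: mean_le => t _; rewrite -natrD ler_nat /good.
  by case: (absorbs _ _); case: (has _ t).
have d_gt0 : 0 < d by rewrite divr_gt0 // exprn_gt0.
have [X0 X0U gX0] : exists2 X, X \in U & good X t.
  apply: contrapT => noX; move: ht; rewrite big1 => [|X _].
    by rewrite leNgt mulr_gt0 // ltr0n.
  by case: (boolP (_ && _)) => // /andP[XU gX]; case: noX; exists X.
have sizeU X : X \in U -> size (enum X) = k.+1.
  by rewrite -cardE inE => /and3P[/eqP].
pose A := [set v in t].
have AD : [disjoint A & D :|: Z].
  have /andP[_ /hasPn hD] := gX0.
  rewrite disjoint_subset; apply/subsetP => v; rewrite inE => /hD.
  by rewrite !inE.
have tA : tileable A.
  have /andP[gA _] := gX0.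
  by have [] := absorbs_tileable (sizeU _ X0U) (enum_uniq _) st gA.
have AZ : [disjoint Z & A].
  by rewrite disjoint_sym; apply: disjointWr AD; apply: subsetUr.
exists (Z :|: A); split.
- exact: tileableU.
- by rewrite -setI_eq0 setIUl setU_eq0 !setI_eq0 dZ (disjointWr _ AD) // subsetUl.
- apply: leq_trans (leq_card_setU _ _) _; rewrite leq_add2l -st cardsE.
  exact: card_size.
pose G := [set X in U | good X t].
have inG X : (X \in G) = (X \in U) && good X t by rewrite in_set.
have htG : d * #|U|%:R <= #|G|%:R.
  apply: le_trans ht _; rewrite -natr_sum ler_nat -sum1_card big_mkcond /=.
  rewrite [X in (_ <= X)%N]big_mkcond leq_sum // => X _.
  by rewrite inG; case: (_ && _).
have GU : G \subset U by apply/subsetP => X; rewrite inG => /andP[].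
suff : (#|unabsorbed (Z :|: A)| + #|G| <= #|U|)%N.
  by rewrite -(ler_nat R) natrD; move: htG; lra.
rewrite -(cardsID G U) addnC (setIidPr GU) leq_add2l; apply/subset_leq_card/subsetP => X.
rewrite inE => /and3P[cX dX /negP ntX].
have [dXZ dXA] : [disjoint X & Z] /\ [disjoint X & A].
  by move: dX; rewrite -!setI_eq0 setIUr setU_eq0 => /andP[].
rewrite in_setD; apply/andP; split; last first.
  rewrite inE cX dXZ /=; apply/negP => tZX; apply: ntX.
  rewrite setUAC; apply: tileableU => //.
  by rewrite -setI_eq0 setIUl setU_eq0 !setI_eq0 AZ dXA.
rewrite inG; apply/negP => /andP[XU /andP[gX _]]; apply: ntX.
have [_ tX] := absorbs_tileable (sizeU _ XU) (enum_uniq _) st gX.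
rewrite -setUA; apply: tileableU => //.
  by rewrite -setI_eq0 setIUr setU_eq0 !setI_eq0 AZ disjoint_sym dXZ.
congr (is_true (tileable _)): tX; apply/setP => v.
by rewrite !inE mem_cat mem_enum orbC.
Qed.

Lemma absorber_steps D m : 
  absorber_size%:R * ((#|D| + m * absorber_size)%:R / n%:R) <= d ->
  exists Z, [/\ tileable Z, [disjoint Z & D], (#|Z| <= m * absorber_size)%N
    & #|unabsorbed Z|%:R <= (1 - d) ^+ m * n%:R ^+ k.+1].
Proof.
elim: m => [|m IHm] hm.
  exists set0; split; rewrite ?tileable0 ?cards0 ?expr0 ?mul1r //.
    by rewrite -setI_eq0 set0I.
  rewrite -natrX ler_nat; apply: leq_trans (bin_le_expn _ _).
  rewrite -card_draws; apply/subset_leq_card/subsetP => X.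
  by rewrite !inE => /and3P[].
have [|Z [tZ dZ cZ uZ]] := IHm.
  apply: le_trans hm; rewrite ler_wpM2l // ler_wpM2r ?invr_ge0 // ler_nat.
  by rewrite leq_add2l leq_mul2r leqnSn orbT.
have [|Z' [tZ' dZ' cZ' uZ']] := absorber_step tZ dZ.
  apply: le_trans hm; rewrite ler_wpM2l // ler_wpM2r ?invr_ge0 // ler_nat.
  apply: leq_trans (leq_card_setU _ _) _; rewrite leq_add2l (leq_trans cZ) //.
  by rewrite leq_mul2r leqnSn orbT.
exists Z'; split=> //; first by rewrite mulSn addnC (leq_trans cZ') // leq_add2r.
apply: le_trans uZ' _; rewrite exprS -mulrA ler_wpM2l //.
by rewrite subr_ge0 d_le1.
Qed.

Variable m : nat.
Hypothesis m_large : (1 - d) ^+ m * n%:R ^+ k.+1 < 1.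

(** When (1 - d) ^+ m * n ^+ k.+1 < 1, fewer than one set is left unabsorbed after
m steps. *)
Lemma absorbing_set D :
  absorber_size%:R * ((#|D| + m * absorber_size)%:R / n%:R) <= d ->
  exists Z, [/\ tileable Z, [disjoint Z & D], (#|Z| <= m * absorber_size)%N
    & forall X, #|X| = k.+1 -> [disjoint X & Z] -> tileable (Z :|: X)].
Proof.
case/absorber_steps=> Z [tZ dZ cZ uZ]; exists Z; split=> // X cX dX.
have := le_lt_trans uZ m_large; rewrite ltrn1 ltnS leqn0 cards_eq0.
by move/eqP/setP/(_ X); rewrite !inE cX eqxx dX => /negbFE.
Qed.

(** The union of J disjoint absorbing sets, each of which takes one group of
k + 1 vertices. *)
Lemma multi_absorbing_set J :
  absorber_size%:R * ((J * (m * absorber_size))%:R / n%:R) <= d ->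
  exists Z, [/\ tileable Z, (#|Z| <= J * (m * absorber_size))%N
    & forall j X, (j <= J)%N -> #|X| = (j * k.+1)%N -> [disjoint X & Z] ->
        tileable (Z :|: X)].
Proof.
elim: J => [|J IHJ] hJ.
  exists set0; split; rewrite ?tileable0 ?cards0 // => j X.
  rewrite leqn0 => /eqP -> /eqP; rewrite mul0n cards_eq0 => /eqP -> _.
  by rewrite set0U tileable0.
have [|Z1 [t1 c1 a1]] := IHJ.
  apply: le_trans hJ; rewrite ler_wpM2l // ler_wpM2r ?invr_ge0 // ler_nat.
  by rewrite leq_mul2r leqnSn orbT.
have [|Z2 [t2 d2 c2 a2]] := @absorbing_set Z1.
  apply: le_trans hJ; rewrite ler_wpM2l // ler_wpM2r ?invr_ge0 // ler_nat.
  by rewrite mulSn addnC leq_add2l.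
have dZ : [disjoint Z1 & Z2] by rewrite disjoint_sym.
exists (Z1 :|: Z2); split; first exact: tileableU.
  by apply: leq_trans (leq_card_setU _ _) _; rewrite mulSn addnC leq_add.
move=> j X jJ cX dX.
have [dX1 dX2] : [disjoint X & Z1] /\ [disjoint X & Z2].
  by move: dX; rewrite -!setI_eq0 setIUr setU_eq0 => /andP[].
case: j jJ cX => [|j] jJ cX.
  move/eqP: cX; rewrite mul0n cards_eq0 => /eqP ->; rewrite setU0.
  exact: tileableU.
have [B BX cB] : exists2 B : {set V}, B \subset X & #|B| = k.+1.
  by apply: subset_card; rewrite cX leq_pmull.
have cXB : #|X :\: B| = (j * k.+1)%N.
  by rewrite cardsD (setIidPr BX) cX cB mulSn addKn.
have dB : [disjoint B & Z2] by apply: disjointWl dX2.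
have dXB : [disjoint X :\: B & Z1] by apply: disjointWl dX1; apply: subsetDl.
have -> : Z1 :|: Z2 :|: X = (Z1 :|: (X :\: B)) :|: (Z2 :|: B).
  apply/setP => v; rewrite !inE; have := subsetP BX v.
  case: (v \in B) => [/(_ isT) ->|_]; first by rewrite !orbT.
  by rewrite orbF -!orbA; congr (_ || _); rewrite orbC.
apply: tileableU; last exact: a2.
  rewrite -setI_eq0 !setIUl !setIUr !setU_eq0 !setI_eq0 dZ disjoint_sym.
  rewrite (disjointWl BX dX1) (disjointWl (subsetDl _ _) dX2) /=.
  by rewrite -setI_eq0 setDE -setIA [~: B :&: B]setIC setICr setI0.
exact: (a1 j).
Qed.

End Absorb.

(** * Covering almost all vertices *)

Lemma trivIset_fill (T : finType) (A : {set T}) s : (0 < s)%N ->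
  exists F : {set {set T}}, [/\ trivIset F, {in F, forall B : {set T}, #|B| = s},
    cover F \subset A & (#|A :\: cover F| < s)%N].
Proof.
move=> s_gt0; have [m] := ubnP #|A|; elim: m A => // m IHm A cA.
have [As|sA] := ltnP #|A| s.
  exists set0; split; rewrite ?/cover ?big_set0 ?sub0set ?setD0 //.
    by apply/trivIsetP => B; rewrite inE.
  by move=> B; rewrite inE.
have [B BA cB] := subset_card sA.
have [|F [tF sF cF fF]] := IHm (A :\: B).
  by rewrite cardsD (setIidPr BA) cB; move: cA s_gt0 sA; clear; lia.
have B0 : set0 \notin F.
  by apply/negP => /sF; rewrite cards0 => s0; rewrite -s0 in s_gt0.
have dB : {in F, forall C : {set T}, [disjoint B & C]}.
  move=> C CF; have CAB : C \subset A :\: B by apply: subset_trans cF; apply: bigcup_sup.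
  rewrite disjoint_sym; apply: disjointWl CAB _.
  by rewrite -setI_eq0 setDE -setIA [~: B :&: B]setIC setICr setI0.
have [tBF _] := trivIsetU1 dB tF B0.
have cov : cover (B |: F) = B :|: cover F by rewrite /cover bigcup_setU big_set1.
exists (B |: F); split => //.
- by move=> C /setU1P[->|/sF].
- by rewrite cov subUset BA (subset_trans cF) // subsetDl.
- by rewrite cov -setDDl.
Qed.

Lemma card_trivIset (T : finType) (F : {set {set T}}) s : trivIset F ->
  {in F, forall B : {set T}, #|B| = s} -> #|cover F| = (#|F| * s)%N.
Proof.
by move=> /eqP <- sF; rewrite (eq_bigr (fun=> s)) ?sum_nat_const.
Qed.

Lemma pigeonhole3 (T I : finType) (A : {set T}) (f : T -> I) :
  (2 * #|I| < #|A|)%N ->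
  exists i, (2 < #|[set x in A | f x == i]|)%N.
Proof.
move=> hA; apply/existsP; apply: contraLR hA => /existsPn h.
rewrite -leqNgt -sum1_card (partition_big f predT) //= mulnC -sum_nat_const.
apply: leq_sum => i _; have := h i; rewrite -leqNgt; apply: leq_trans.
by rewrite sum1_card; apply/subset_leq_card/subsetP => x; rewrite !inE.
Qed.

(** With N sets T, w vertices in W, g blocks of size m, G = g^2 and C vertices
outside the blocks, the right-hand side of the last hypothesis bounds the number
of completing pairs when every slice has more than two of them for at most Q of
the sets T. Its main term is 2 G m <= 2 w^2 / m for each T, and the other terms
are absorbed by the surplus delta. *)
Lemma tiling_arith (R : realFieldType) (delta w N C m G Q : R) :
  0 < delta -> 0 < m -> 0 <= C -> 0 <= Q ->
  2 * Q < delta * N -> 2 * (2 * C + m) <= delta * w -> G * (m * m) <= w * w ->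
  N * ((2 / m + delta) * w ^+ 2) <=
    N * (2 * (C * w) + m * w + 2 * (G * m)) + m * (G * m * Q) -> False.
Proof.
move=> d0 m0 C0 Q0 hN hw hG h.
have w0 : 0 < w by rewrite -(pmulr_rgt0 _ d0); apply: lt_le_trans hw; lra.
have N0 : 0 < N by rewrite -(pmulr_rgt0 _ d0); apply: le_lt_trans hN; lra.
have i0 : 0 < m^-1 by rewrite invr_gt0.
have e1 : N * 2 * m^-1 * (G * (m * m)) = N * 2 * (G * m) by field; rewrite lt0r_neq0.
have h1 : N * 2 * m^-1 * (G * (m * m)) <= N * 2 * m^-1 * (w * w).
  by rewrite ler_pM2l // !mulr_gt0.
have h2 : N * w * (2 * (2 * C + m)) <= N * w * (delta * w) by rewrite ler_pM2l ?mulr_gt0.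
have h3 : Q * (G * (m * m)) <= Q * (w * w) by rewrite ler_wpM2l.
have h4 : w * w * (2 * Q) < w * w * (delta * N) by rewrite ltr_pM2l ?mulr_gt0.
move: h h1 h2 h3 h4; rewrite e1 expr2; clear.
have -> : N * ((2 / m + delta) * (w * w)) = N * 2 * m^-1 * (w * w) + delta * N * w * w by ring.
lra.
Qed.

Section AlmostTiling.
Variables (k : nat) (H : kgraph k) (e : nat).
Local Notation V := (vert H).
Hypothesis hk : (4 <= k)%N.
Hypothesis hbad : forall T : {set V}, #|T| = k.-1 -> (#|bad T| <= e)%N.
Variable W : {set V}.
Local Notation w := #|W|.
Implicit Types (A K G S T U : {set V}) (u v x : V) (F : {set {set V}}).
Let k1 : (1 < k)%N. Proof. exact: leq_trans hk. Qed.

(** For #|T| = k.-1 the cardinality of a clique forces u and v to be distinct and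
outside T. *)
Definition completes T u v := clique (v |: (u |: T)).

Lemma pairs_count T : #|T| = k.-1 ->
  ((w - e) * (w - k * e) <= \sum_(u in W) \sum_(v in W) completes T u v)%N.
Proof.
move=> cT; rewrite (big_setID (bad T)) /= (leq_trans _ (leq_addl _ _)) //.
apply: (@leq_trans (\sum_(u in W :\: bad T) (w - k * e))%N).
  rewrite sum_nat_const leq_mul2r cardsD; apply/orP; right; apply: leq_sub2l.
  by apply: leq_trans (hbad cT); apply/subset_leq_card/subsetIr.
apply: leq_sum => u; rewrite in_setD => /andP[ub _].
have uE : u |: T \in edges H by move: ub; rewrite inE negbK.
have := ext_bound W k1 uE.
have : (\sum_(x in u |: T) #|bad ((u |: T) :\ x) :&: W| <= k * e)%N.
  rewrite -[X in (_ <= X * _)%N](edges_uniform uE) -sum_nat_const leq_sum // => x xu.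
  apply: leq_trans (subset_leq_card (subsetIl _ _)) _; apply: hbad.
  by have := cardsD1 x (u |: T); rewrite xu (edges_uniform uE); clear; lia.
have : (#|ext (u |: T) :&: W| <= \sum_(v in W) completes T u v)%N.
  rewrite -sum1_card big_mkcond [X in (_ <= X)%N]big_mkcond; apply: leq_sum => v _.
  rewrite in_setI; case: (v \in W); rewrite ?andbF ?andbT //.
  by case: (boolP (v \in ext _)) => //; rewrite inE => /andP[_]; rewrite /completes => ->.
by set a := #|_|; set b := (\sum_(x in u |: T) _)%N; set c := (\sum_(v in W) _)%N; clear; lia.
Qed.

Lemma pairs_restrict (C : {set V}) (f : V -> V -> bool) : C \subset W ->
  (\sum_(u in W) \sum_(v in W) f u v <=
   \sum_(u in C) \sum_(v in C) f u v + 2 * (#|W :\: C| * w))%N.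
Proof.
move=> CW; rewrite (big_setID C) /= (setIidPr CW).
have h1 : (\sum_(u in W :\: C) \sum_(v in W) f u v <= #|W :\: C| * w)%N.
  rewrite -sum_nat_const leq_sum // => u _; rewrite -sum1_card leq_sum // => v _.
  exact: leq_b1.
have h2 : (\sum_(u in C) \sum_(v in W) f u v <=
   \sum_(u in C) \sum_(v in C) f u v + #|W :\: C| * w)%N.
  have : (\sum_(u in C) #|W :\: C| <= #|W :\: C| * w)%N.
    by rewrite sum_nat_const mulnC leq_mul2l subset_leq_card ?orbT.
  move=> h; apply: leq_trans (leq_add (leqnn _) h); rewrite -big_split leq_sum //= => u _.
  rewrite (big_setID C) /= (setIidPr CW) leq_add2l -sum1_card leq_sum // => v _.
  exact: leq_b1.
by move: h1 h2; clear; lia.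
Qed.

Variable x0 : V.
Definition entry A (j : 'I_k.+1) := nth x0 (enum A) j.

Lemma entry_inj A i j : #|A| = k.+1 -> entry A i = entry A j -> i = j.
Proof.
move=> cA /eqP; rewrite /entry nth_uniq ?enum_uniq -?cardE ?cA // => /eqP ij.
exact: val_inj.
Qed.

Lemma entry_mem A j : #|A| = k.+1 -> entry A j \in A.
Proof. by move=> cA; rewrite -mem_enum mem_nth // -cardE cA. Qed.

Lemma sum_entry A (f : V -> nat) : #|A| = k.+1 ->
  (\sum_(u in A) f u = \sum_(j < k.+1) f (entry A j))%N.
Proof. by move=> cA; rewrite -big_enum (big_nth x0) -cardE cA big_mkord. Qed.

(** Two blocks A and B of size k + 1 are matched by sending the j-th entry of A to
the (j + d)-th entry of B; over the k + 1 shifts d these matchings partition the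
product of A and B. A slice counts the pairs of one matching that satisfy f. *)
Definition slice (f : V -> V -> bool) (g : {set V} * {set V} * 'I_k.+1) : nat :=
  (\sum_(j < k.+1) f (entry g.1.1 j) (entry g.1.2 (j + g.2)%R))%N.

Lemma sum_slices F (f : V -> V -> bool) : trivIset F ->
  {in F, forall A : {set V}, #|A| = k.+1} ->
  (\sum_(u in cover F) \sum_(v in cover F) f u v
    = \sum_(A in F) \sum_(B in F) \sum_(d < k.+1) slice f (A, B, d))%N.
Proof.
move=> tF sF; rewrite big_trivIset //; apply: eq_bigr => A AF.
rewrite sum_entry ?sF //.
rewrite (eq_bigr (fun j => \sum_(B in F) \sum_(i < k.+1) f (entry A j) (entry B i))%N).
  rewrite exchange_big; apply: eq_bigr => B BF.
  rewrite /slice [RHS]exchange_big /=; apply: eq_bigr => j _.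
  rewrite (reindex (fun d => j + d)%R) //; exists (fun d => d - j)%R => d _.
    by rewrite addrAC subrr add0r.
  by rewrite addrC subrK.
move=> j _; rewrite big_trivIset //; apply: eq_bigr => B BF.
by rewrite sum_entry ?sF.
Qed.

(** Averaging over T, over the pairs of blocks and over the shifts: if every slice
had at most two completing pairs for almost all T, the number of completing pairs
would be at most about 2 w^2 / (k + 1). *)
Lemma almost_tiling_count (R : realFieldType) (delta : R) N (TT F : {set {set V}}) :
  0 < delta -> (4 * 2 ^ k.+1)%:R < delta * N%:R ->
  (2 * (2 * (k.-1 * N + k) + k.+1))%:R <= delta * w%:R ->
  (2 / k.+1%:R + delta) * w%:R ^+ 2 <= ((w - e) * (w - k * e))%:R ->
  #|TT| = N -> {in TT, forall T : {set V}, #|T| = k.-1} ->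
  trivIset F -> {in F, forall A : {set V}, #|A| = k.+1} -> cover F \subset W ->
  (#|W :\: cover F| <= k.-1 * N + k)%N ->
  exists A B d, [/\ A \in F, B \in F, A != B &
    (2 * 2 ^ k.+1 < #|[set T in TT | 2 < slice (completes T) (A, B, d)]|)%N].
Proof.
move=> delta_gt0 hN hw hdens cTT sTT tF sF FW cF; apply: contrapT => noABd.
pose good A B d := #|[set T in TT | (2 < slice (completes T) (A, B, d))%N]|.
have good_le A B d : A \in F -> B \in F -> A != B -> (good A B d <= 2 * 2 ^ k.+1)%N.
  by move=> AF BF AB; rewrite leqNgt; apply/negP => h; apply: noABd; exists A, B, d.
pose m := k.+1; pose g := #|F|; pose C := (k.-1 * N + k)%N.
have gm : (g * m <= w)%N by rewrite -(card_trivIset tF sF) subset_leq_card.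
have slice_m f p : (slice f p <= m)%N.
  apply: (@leq_trans (\sum_(j < m) 1)%N); last by rewrite sum1_card card_ord.
  by apply: leq_sum => j _; apply: leq_b1.
have slice_le f p : (slice f p <= 2 + m * (2 < slice f p))%N.
  case: (ltnP 2 (slice f p)) => [_|]; rewrite ?muln0 ?addn0 // muln1.
  by apply: leq_trans (slice_m _ _) _; apply: leq_addl.
have diag f A : (\sum_(d < m) slice f (A, A, d) <= m * m)%N.
  apply: (@leq_trans (\sum_(d < m) m)%N); last by rewrite sum_nat_const card_ord.
  by apply: leq_sum => d _; apply: slice_m.
have one T : T \in TT -> ((w - e) * (w - k * e) <= 2 * (C * w) + m * w + 2 * (g * g * m)
    + m * \sum_(A in F) \sum_(B in F | B != A) \sum_(d < m) (2 < slice (completes T) (A, B, d)))%N.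
  move=> TTT; apply: leq_trans (pairs_count (sTT T TTT)) _.
  apply: leq_trans (pairs_restrict _ FW) _; rewrite sum_slices //.
  have hC : (2 * (#|W :\: cover F| * w) <= 2 * (C * w))%N by rewrite leq_mul2l leq_mul2r cF orbT.
  have : (\sum_(A in F) \sum_(B in F) \sum_(d < m) slice (completes T) (A, B, d) <=
     m * w + (2 * (g * g * m)
    + m * \sum_(A in F) \sum_(B in F | B != A) \sum_(d < m) (2 < slice (completes T) (A, B, d))))%N.
    have h1 : (\sum_(A in F) m * m <= m * w)%N.
      by rewrite sum_nat_const mulnA -/g mulnC leq_mul2l gm orbT.
    have h2 : (\sum_(A in F) g * (m * 2) = 2 * (g * g * m))%N.
      by rewrite sum_nat_const -/g; clear; lia.
    rewrite -h2 big_distrr -big_split /=; apply: leq_trans (leq_add h1 (leqnn _)).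
    rewrite -big_split leq_sum //= => A AF; rewrite (bigD1 A AF) leq_add ?diag //.
    have h3 : (\sum_(B in F | B != A) \sum_(d < m) 2 <= g * (m * 2))%N.
      apply: (@leq_trans (\sum_(B in F) \sum_(d < m) 2)%N).
        by rewrite [leqRHS](bigD1 A AF) leq_addl.
      by rewrite !sum_nat_const card_ord.
    apply: leq_trans (leq_add h3 (leqnn _)); rewrite big_distrr -big_split leq_sum //= => B _.
    rewrite big_distrr -big_split leq_sum //= => d _; exact: slice_le.
  move=> h; apply: leq_trans (leq_add h hC) _.
  by rewrite addnC !addnA.
have sum_good : (\sum_(T in TT) \sum_(A in F) \sum_(B in F | B != A) \sum_(d < m)
      (2 < slice (completes T) (A, B, d)) <= g * g * m * (2 * 2 ^ m))%N.
  rewrite exchange_big /=.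
  apply: (@leq_trans (\sum_(A in F) g * m * (2 * 2 ^ m))%N); last first.
    by rewrite sum_nat_const -/g !mulnA.
  apply: leq_sum => A AF; rewrite exchange_big /=.
  apply: (@leq_trans (\sum_(B in F | B != A) m * (2 * 2 ^ m))%N); last first.
    apply: (@leq_trans (\sum_(B in F) m * (2 * 2 ^ m))%N).
      by rewrite [leqRHS](bigD1 A AF) leq_addl.
    by rewrite sum_nat_const -/g !mulnA.
  apply: leq_sum => B /andP[BF BA]; rewrite exchange_big /=.
  apply: (@leq_trans (\sum_(d < m) 2 * 2 ^ m)%N); last by rewrite sum_nat_const card_ord.
  apply: leq_sum => d _; have := good_le A B d AF BF; rewrite eq_sym BA => /(_ isT).
  apply: leq_trans; rewrite /good -sum1_card big_mkcond [leqRHS]big_mkcond leq_sum // => T _.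
  by rewrite inE; case: (T \in TT); case: (2 < _)%N.
have total : (N * ((w - e) * (w - k * e)) <= N * (2 * (C * w) + m * w + 2 * (g * g * m))
    + m * (g * g * m * (2 * 2 ^ m)))%N.
  have hs : (\sum_(T in TT) (w - e) * (w - k * e) <= \sum_(T in TT)
    (2 * (C * w) + m * w + 2 * (g * g * m) + m * \sum_(A in F) \sum_(B in F | B != A)
      \sum_(d < m) (2 < slice (completes T) (A, B, d))))%N by exact: leq_sum.
  move: hs; rewrite sum_nat_const big_split /= sum_nat_const -big_distrr cTT => /leq_trans; apply.
  by rewrite leq_add2l leq_mul2l sum_good orbT.
have gmw : (g * g * (m * m) <= w * w)%N by rewrite mulnACA leq_mul.
move: total; rewrite -(ler_nat R) natrM => total.
have N0 : 0 <= N%:R :> R by [].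
have {hdens total} h1 := le_trans (ler_wpM2l N0 hdens) total.
have m0 : 0 < k.+1%:R :> R by rewrite ltr0n.
apply: (@tiling_arith R delta w%:R N%:R C%:R m%:R (g * g)%:R (2 * 2 ^ m)%:R) => //.
- by move: hN; rewrite -[4%N]/(2 * 2)%N -mulnA natrM.
- by move: hw; rewrite natrM natrD natrM.
- by rewrite -!natrM ler_nat.
by move: h1; rewrite !(natrD, natrM).
Qed.

(** Each of A and B may be a block of the tiling of U or an auxiliary block outside
U, as [almost_tiling_count] does not tell the two kinds apart. *)
Lemma tileable_remove U (PP FF : {set {set V}}) A B :
  partition PP U -> {in PP, forall K : {set V}, clique K} ->
  trivIset (PP :|: FF) -> [disjoint U & cover FF] ->
  A \in PP :|: FF -> B \in PP :|: FF -> tileable (U :\: (A :|: B)).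
Proof.
move=> /and3P[/eqP cU tPP P0] kP tG dU AG BG.
pose QQ := [set K in PP | (K != A) && (K != B)].
have QP : QQ \subset PP by apply/subsetP => K; rewrite inE => /andP[].
have inU K : K \in PP -> K \subset U by move=> KP; rewrite -cU; apply: bigcup_sup.
have disj K L : K \in PP -> L \in PP :|: FF -> K != L -> [disjoint K & L].
  by move=> KP LG KL; apply: (trivIsetP tG) => //; rewrite inE KP.
apply/tileableP; exists QQ; last by move=> K KQ; apply/kP/(subsetP QP).
apply/and3P; split; [|exact: trivIsetS tPP|by apply: contra P0; apply: (subsetP QP)].
apply/eqP/setP => v; rewrite !inE negb_or; apply/bigcupP/andP.
  move=> [K]; rewrite inE => /and3P[KP KA KB] vK.
  rewrite (subsetP (inU K KP)) //; split=> //.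
  by rewrite (disjointFr (disj K A KP AG KA) vK) (disjointFr (disj K B KP BG KB) vK).
move=> [/andP[vA vB] vU]; move: vU; rewrite -cU => /bigcupP[K KP vK].
exists K => //; rewrite inE KP /=; apply/andP; split.
  by apply: contraNneq vA => <-.
by apply: contraNneq vB => <-.
Qed.

Lemma almost_tiling (R : realFieldType) (delta : R) N :
  0 < delta -> (4 * 2 ^ k.+1)%:R < delta * N%:R ->
  (2 * (2 * (k.-1 * N + k) + k.+1))%:R <= delta * w%:R ->
  (2 / k.+1%:R + delta) * w%:R ^+ 2 <= ((w - e) * (w - k * e))%:R ->
  exists U, [/\ U \subset W, tileable U & (#|W :\: U| < k.-1 * N)%N].
Proof.
move=> delta_gt0 hN hw hdens.
pose ok U := tileable U && (U \subset W).
have ok0 : ok set0 by rewrite /ok tileable0 sub0set.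
case: (@arg_maxnP _ set0 ok (fun U => #|U|) ok0) => U /andP[tU UW] maxU.
exists U; split => //; rewrite ltnNge; apply/negP => big.
have k0 : (0 < k.-1)%N by move: hk; clear; lia.
have [T0 [tT0 sT0 cT0 fT0]] := trivIset_fill (W :\: U) k0.
have NT0 : (N <= #|T0|)%N.
  rewrite -ltnS -(ltn_pmul2r k0) mulSn -(card_trivIset tT0 sT0).
  apply: (@leq_ltn_trans #|W :\: U|); first by rewrite mulnC.
  by rewrite -(cardsID (cover T0)) (setIidPr cT0) addnC ltn_add2r.
have [TT TT0 cTT] := subset_card NT0.
have tTT := trivIsetS TT0 tT0.
have sTT : {in TT, forall T : {set V}, #|T| = k.-1} by move=> T /(subsetP TT0)/sT0.
have TWU T : T \in TT -> T \subset W :\: U.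
  by move=> /(subsetP TT0) TT0'; apply: subset_trans cT0; apply: bigcup_sup.
have cTTWU : cover TT \subset W :\: U by apply/bigcupsP => T; apply: TWU.
(* Auxiliary blocks fill up what is left after U and the sets T, so that almost
   all of W lies in blocks of size k + 1. *)
have [FF [tFF sFF cFF fFF]] := @trivIset_fill _ (W :\: U :\: cover TT) k.+1 isT.
have [PP pPP kPP] := tileableP U tU.
have /and3P[/eqP cPP tPP P0] := pPP.
have dU : [disjoint U & cover FF].
  rewrite disjoint_sym; apply: disjointWl cFF _; rewrite -setI_eq0; apply/eqP/setP => v.
  by rewrite !inE; case: (v \in U); rewrite ?andbF.
pose GG := PP :|: FF.
have tGG : trivIset GG by apply: trivIsetU => //; rewrite cPP.
have sGG : {in GG, forall A : {set V}, #|A| = k.+1}.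
  by move=> A /setUP[/kPP/clique_card|/sFF].
have covG : cover GG = U :|: cover FF by rewrite /cover bigcup_setU -!/(cover _) cPP.
have FFW : cover FF \subset W.
  by apply: subset_trans cFF _; apply: subset_trans (subsetDl _ _) (subsetDl _ _).
have GW : cover GG \subset W by rewrite covG subUset UW FFW.
have cG : (#|W :\: cover GG| <= k.-1 * N + k)%N.
  have h : W :\: cover GG \subset cover TT :|: (W :\: U :\: cover TT :\: cover FF).
    apply/subsetP => v; rewrite covG !inE.
    by case: (v \in U); case: (v \in cover TT); case: (v \in cover FF); case: (v \in W).
  apply: leq_trans (subset_leq_card h) _; apply: leq_trans (leq_card_setU _ _) _.
  by rewrite leq_add // (card_trivIset tTT sTT) cTT mulnC.
have [A [B [d [AG BG AB hd]]]] :=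
  almost_tiling_count delta_gt0 hN hw hdens cTT sTT tGG sGG GW cG.
pose J T := [set j | completes T (entry A j) (entry B (j + d)%R)].
have sliceJ T : slice (completes T) (A, B, d) = #|J T|.
  rewrite -sum1_card big_mkcond /=; apply: eq_bigr => j _.
  by rewrite inE; case: (completes _ _ _).
(* There are 2 ^ k.+1 sets of positions and more than twice as many sets T, so
   three of them have the same good positions. *)
have [|J0] := @pigeonhole3 _ _ [set T in TT | (2 < slice (completes T) (A, B, d))%N] J.
  by apply: leq_trans hd; rewrite -cardsT -powersetT card_powerset cardsT card_ord.
case/card_gt2P=> T1 [T2 [T3 [[+ + +] [T12 T23 T31]]]].
have inS T : (T \in [set T in [set T in TT | (2 < slice (completes T) (A, B, d))%N] | J T == J0])
    -> T \in TT /\ J T = J0 by rewrite !inE => /andP[/andP[-> _] /eqP].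
move=> T1S /inS[T2T J2] /inS[T3T J3].
have /card_gt2P[j1 [j2 [j3 [[j1J j2J j3J] [j12 j23 j31]]]]] : (2 < #|J0|)%N.
  by move: T1S; rewrite !inE => /andP[/andP[_ +] /eqP <-]; rewrite sliceJ.
have {T1S} [T1T J1] := inS _ T1S.
pose K T j := entry B (j + d)%R |: (entry A j |: T).
have cK T j : j \in J T -> clique (K T j) by rewrite inE.
have sA := sGG _ AG; have sB := sGG _ BG.
have dAB : [disjoint A & B] by apply: (trivIsetP tGG).
have inG C : C \in GG -> C \subset cover GG by move=> CG; apply: bigcup_sup.
have dTG T : T \in TT -> [disjoint T & cover GG].
  move=> TT'; rewrite covG -setI_eq0 setIUr setU_eq0 !setI_eq0; apply/andP; split.
    apply: disjointWl (TWU _ TT') _.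
    by rewrite -setI_eq0 setDE -setIA [~: U :&: U]setIC setICr setI0.
  have TcT : T \subset cover TT by apply: bigcup_sup.
  rewrite disjoint_sym; apply: disjointWl cFF _; apply: disjointWr TcT _.
  by rewrite -setI_eq0 setDE -setIA [~: _ :&: _]setIC setICr setI0.
have KAB T j v : v \in K T j -> [|| v \in A, v \in B | v \in T].
  by rewrite !inE => /or3P[/eqP->|/eqP->|->]; rewrite ?entry_mem ?orbT.
have dK T T' j j' : T \in TT -> T' \in TT -> T != T' -> j != j' -> [disjoint K T j & K T' j'].
  move=> TTT TTT' TnT jnj; rewrite disjoint_subset; apply/subsetP => v.
  have dT : [disjoint T & T'] by apply: (trivIsetP tTT).
  have nT C T'' u : C \in GG -> T'' \in TT -> u \in C -> u \notin T''.
    move=> CG T''T uC; apply/negP => uT''.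
    by have := disjointFr (dTG _ T''T) uT''; rewrite (subsetP (inG _ CG)).
  have nel (i i' : 'I_k.+1) : entry A i != entry B i'.
    apply: contraTneq (entry_mem i sA) => ->.
    by rewrite (disjointFl dAB) // entry_mem.
  rewrite !inE !negb_or => /or3P[/eqP->|/eqP->|vT]; apply/and3P; split.
  - by apply: contra jnj => /eqP/(entry_inj sB)/addIr ->.
  - by rewrite eq_sym.
  - by apply: (nT B) => //; apply: entry_mem.
  - by [].
  - by apply: contra jnj => /eqP/(entry_inj sA) ->.
  - by apply: (nT A) => //; apply: entry_mem.
  - by apply: contraTneq vT => ->; apply: (nT B) => //; apply: entry_mem.
  - by apply: contraTneq vT => ->; apply: (nT A) => //; apply: entry_mem.
  - by rewrite (disjointFr dT).
pose X := U :\: (A :|: B).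
have tX : tileable X := tileable_remove pPP kPP tGG dU AG BG.
have dXK T j : T \in TT -> [disjoint X & K T j].
  move=> TTT; rewrite disjoint_sym disjoint_subset; apply/subsetP => v /KAB.
  rewrite !inE; case/or3P => [->|->|vT]; rewrite ?orbT //.
  have := subsetP (TWU _ TTT) v vT; rewrite inE => /andP[/negPf -> _].
  by rewrite andbF.
have KW T j : T \in TT -> K T j \subset W.
  move=> TTT; apply/subsetP => v /KAB/or3P[vA|vB|vT].
  - exact: (subsetP GW) (subsetP (inG _ AG) v vA).
  - exact: (subsetP GW) (subsetP (inG _ BG) v vB).
  - exact: (subsetP (subset_trans (TWU _ TTT) (subsetDl _ _))).
have c1 := cK T1 j1; have c2 := cK T2 j2; have c3 := cK T3 j3.
rewrite {}J1 {}J2 {}J3 in c1 c2 c3.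
have {}c1 := c1 j1J; have {}c2 := c2 j2J; have {}c3 := c3 j3J.
have d1 := dXK T1 j1 T1T; have d2 := dXK T2 j2 T2T; have d3 := dXK T3 j3 T3T.
have d12 := dK _ _ _ _ T1T T2T T12 j12; have d23 := dK _ _ _ _ T2T T3T T23 j23.
have d13 : [disjoint K T1 j1 & K T3 j3] by rewrite disjoint_sym; apply: dK.
(* Two blocks at most are lost and three cliques are gained. *)
pose U' := X :|: (K T1 j1 :|: (K T2 j2 :|: K T3 j3)).
have dU2 (C D E : {set V}) : [disjoint C & D] -> [disjoint C & E] -> [disjoint C & D :|: E].
  by rewrite -!setI_eq0 setIUr setU_eq0 => -> ->.
have d1' := dU2 _ _ _ d12 d13; have dX := dU2 _ _ _ d1 (dU2 _ _ _ d2 d3).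
have tU' : tileable U'.
  apply: (tileableU dX tX); apply: (tileableU d1' (clique_tileable c1)).
  exact: tileableU d23 (clique_tileable c2) (clique_tileable c3).
have U'W : U' \subset W.
  have XW : X \subset W by apply: subset_trans (subsetDl _ _) UW.
  have subU (C D : {set V}) : C \subset W -> D \subset W -> C :|: D \subset W.
    by move=> CW DW; rewrite subUset CW.
  exact: subU XW (subU _ _ (KW _ _ T1T) (subU _ _ (KW _ _ T2T) (KW _ _ T3T))).
have := maxU U'; rewrite /ok tU' U'W /= => /(_ isT).
have cX : (#|U| <= #|X| + 2 * k.+1)%N.
  rewrite -(cardsID (A :|: B) U) addnC leq_add2l.
  apply: leq_trans (subset_leq_card (subsetIr _ _)) _.
  by apply: leq_trans (leq_card_setU _ _) _; rewrite sA sB mul2n addnn.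
have cD (C D : {set V}) : [disjoint C & D] -> #|C :|: D| = (#|C| + #|D|)%N.
  by move=> /disjoint_setI0 CD; rewrite cardsU CD cards0 subn0.
rewrite /geq /= (cD _ _ dX) (cD _ _ d1') (cD _ _ d23).
by rewrite (clique_card c1) (clique_card c2) (clique_card c3); move: cX; clear; lia.
Qed.

End AlmostTiling.

(** * Growth estimates *)

Section Growth.
Variable R : archiRealFieldType.
Implicit Types (a b r delta : R).

Lemma eventually_ge a b : 0 < a -> exists n0, forall n, (n0 <= n)%N -> b <= a * n%:R.
Proof.
move=> a0; exists (Num.trunc (b / a)).+1 => n hn.
rewrite mulrC -ler_pdivrMr //; apply: le_trans (ltW (truncnS_gt _)) _.
by rewrite ler_nat.
Qed.

Lemma bernoulli delta m : 0 <= delta -> 1 + m%:R * delta <= (1 + delta) ^+ m.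
Proof.
move=> d0; elim: m => [|m IHm]; first by rewrite mul0r addr0 expr0.
rewrite exprS; apply: le_trans (ler_wpM2l _ IHm); last by rewrite addr_ge0.
rewrite -natr1; have : 0 <= m%:R * delta * delta by rewrite !mulr_ge0.
by set x := m%:R; lra.
Qed.

(** By Bernoulli's inequality a power of r^-1 with exponent n / (q (K + 1)) grows
linearly, so its (K + 1)-st power outgrows n ^+ K. *)
Lemma exp_beats_power r K q : 0 <= r -> r < 1 -> (0 < q)%N ->
  exists n0, forall n, (n0 <= n)%N -> r ^+ (n %/ q) * n%:R ^+ K < 1.
Proof.
rewrite le0r => /predU1P[-> _|r0 r1] q0.
  exists q => n qn; have : (0 < n %/ q)%N by rewrite divn_gt0.
  by case: (n %/ q)%N => // m _; rewrite exprS !mul0r ltr01.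
pose delta := r^-1 - 1; have d0 : 0 < delta by rewrite subr_gt0 invf_gt1.
pose Q := (q * K.+1)%N; have Q0 : (0 < Q)%N by rewrite muln_gt0 q0.
have [A hA] := eventually_ge (((2 * Q)%:R ^+ K + 1)) (exprn_gt0 K.+1 d0).
exists (Q * A.+1)%N => n hn; pose a := (n %/ Q)%N.
have Aa : (A.+1 <= a)%N by rewrite leq_divRL // mulnC.
have na : (n <= a * (2 * Q))%N.
  have := divn_eq n Q; have := ltn_pmod n Q0; rewrite -/a.
  by move: (n %% Q)%N => s; move: Aa Q0; clear; nia.
have rE : r ^+ (n %/ q) = ((1 + delta) ^+ (n %/ q))^-1.
  by rewrite /delta addrCA subrr addr0 exprVn invrK.
have d1 : 0 < 1 + delta by apply: addr_gt0.
rewrite rE mulrC ltr_pdivrMr ?mul1r; last exact: exprn_gt0.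
apply: (@lt_le_trans _ _ ((a%:R * delta) ^+ K.+1)).
  apply: (@le_lt_trans _ _ ((a * (2 * Q))%:R ^+ K)).
    by apply: lerXn2r; rewrite ?nnegrE // ler_nat.
  rewrite natrM !exprMn [in ltRHS]exprS -mulrA [a%:R * _]mulrCA ltr_pM2l; last first.
    by rewrite exprn_gt0 // ltr0n (leq_trans _ Aa).
  by rewrite mulrC; have := hA a (ltnW Aa); lra.
have aK : (a * K.+1 <= n %/ q)%N by rewrite /a /Q divnMA leq_trunc_div.
apply: (@le_trans _ _ ((1 + delta) ^+ (a * K.+1))); last first.
  by rewrite ler_weXn2l // lerDl ltW.
have b1 : 0 <= a%:R * delta by rewrite mulr_ge0 // ltW.
have b2 : 0 <= (1 + delta) ^+ a by rewrite exprn_ge0 // addr_ge0 // ltW.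
rewrite exprM; apply: lerXn2r; rewrite ?nnegrE //.
by apply: le_trans (bernoulli a (ltW d0)); rewrite lerDr.
Qed.

End Growth.

(** * The upper bound *)

Section TilingDensity.
Variables (R : realFieldType) (k : nat).
Hypothesis hk : (4 <= k)%N.
Let K : R := k%:R.
(** The proportion of the vertices that a (k-1)-set may miss, up to gamma. *)
Definition eps : R := (K + (odd k)%:R) / (2 * K ^+ 2).
(** The surplus of completing pairs over the proportion 2 / (k + 1) that is needed
to enlarge a tiling. *)
Definition margin : R := (1 - eps) * (1 - K * eps) - 2 / k.+1%:R.

Lemma eps_facts : [/\ 0 < eps, eps <= 1 / 4 & K * eps <= 5 / 8].
Proof.
have K4 : 4 <= K by rewrite (ler_nat R 4).
have K0 : 0 < K by lra.
have o0 : 0 <= (odd k)%:R :> R by [].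
have o1 : (odd k)%:R <= 1 :> R by rewrite lern1 leq_b1.
have K2 : 0 < 2 * K ^+ 2 by rewrite mulr_gt0 ?exprn_gt0.
split.
- by rewrite divr_gt0 //; lra.
- by rewrite ler_pdivrMr // expr2; nra.
- by rewrite mulrA ler_pdivrMr // expr2; nra.
Qed.

(** For even k the claim is 2 k^2 - 7 k - 1 > 0, and for odd k it is
2 k^4 - 9 k^3 - 3 k^2 + k + 1 > 0; the first holds from 4 on and the second from
5 on. *)
Lemma margin_gt0 : 0 < margin.
Proof.
have K4 : 4 <= K by rewrite (ler_nat R 4).
have K0 : 0 < K by lra.
have kE : k.+1%:R = K + 1 :> R by rewrite -natr1.
rewrite /margin /eps kE -/K subr_gt0 ltr_pdivrMr; last by lra.
have [ok|/negbTE ek] := boolP (odd k).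
  have -> : true%:R = 1 :> R by [].
  have K5 : 5 <= K.
    rewrite (ler_nat R 5) ltn_neqAle hk andbT; apply: contraTneq ok => <-.
    by [].
  have -> : (1 - (K + 1) / (2 * K ^+ 2)) * (1 - K * ((K + 1) / (2 * K ^+ 2))) * (K + 1)
     = (2 * K ^+ 4 - K ^+ 3 - 3 * K ^+ 2 + K + 1) / (4 * K ^+ 3).
    by field; rewrite lt0r_neq0.
  rewrite ltr_pdivlMr ?mulr_gt0 ?exprn_gt0 //.
  have [x x0 ->] : exists2 x, 0 <= x & K = 5 + x by exists (K - 5); lra.
  rewrite -subr_gt0.
  have -> : 2 * (5 + x) ^+ 4 - (5 + x) ^+ 3 - 3 * (5 + x) ^+ 2 + (5 + x) + 1 - 2 * (4 * (5 + x) ^+ 3)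
    = 2 * x ^+ 4 + 31 * x ^+ 3 + 162 * x ^+ 2 + 296 * x + 56 by ring.
  have : 0 <= x ^+ 4 by apply: exprn_ge0. have : 0 <= x ^+ 3 by apply: exprn_ge0.
  have : 0 <= x ^+ 2 by apply: exprn_ge0.
  by move: x0; lra.
rewrite addr0.
have -> : (1 - K / (2 * K ^+ 2)) * (1 - K * (K / (2 * K ^+ 2))) * (K + 1)
   = (2 * K - 1) * (K + 1) / (4 * K) by field; rewrite lt0r_neq0.
by rewrite ltr_pdivlMr ?mulr_gt0 //; nra.
Qed.

End TilingDensity.

(** The number N bounds the leftover of the almost tiling by J = (k - 1) N, so J
absorbing sets are needed. Their total size is at most mu n with mu <= g, hence
the codegree condition survives, with eps in place of eps - g, in the complement W
of their union. *)
Lemma tileable_of_codegree (R : archiRealFieldType) k (hk : (4 <= k)%N) (g : R) : 0 < g ->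
  exists n0, forall n, (n0 <= n)%N -> (k.+1 %| n)%N -> forall H : kgraph k,
    Defs.order H = n -> (1 - eps R k + g) * n%:R <= (min_codeg H)%:R ->
    tileable [set: vert H].
Proof.
move=> g0; have [eps0 eps1 keps] := eps_facts R hk.
have k0 : 0 < k%:R :> R by rewrite ltr0n (leq_trans _ hk).
have kS0 : 0 < k.+1%:R :> R by rewrite ltr0n.
pose beta := 2 * k%:R ^+ 2 * g.
have beta0 : 0 < beta by rewrite !mulr_gt0 // exprn_gt0.
pose theta := Num.min (beta / (2 * k.+1%:R)) (1 / 1024).
have theta0 : 0 < theta by rewrite lt_min divr_gt0 ?mulr_gt0 //=; lra.
have theta_small : theta <= 1 / 1024 by rewrite ge_min lexx orbT.
have theta_beta : 2 * k.+1%:R * theta <= beta.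
  by rewrite mulrC -ler_pdivlMr ?mulr_gt0 // ge_min lexx.
pose kappa := theta * (beta / k.+1%:R * (1 / 1024) ^+ k) / 1024 ^+ 3.
have kappa0 : 0 < kappa.
  rewrite divr_gt0 ?exprn_gt0 // mulr_gt0 // mulr_gt0 ?divr_gt0 // exprn_gt0 //; lra.
pose c := Num.min (kappa / 2) (1 / 96).
have c0 : 0 < c by rewrite lt_min; lra.
have [c_kap c_96] : c <= kappa / 2 /\ c <= 1 / 96 by rewrite !ge_min !lexx orbT.
pose L := link_size k; pose M := absorber_size k L; pose d := c ^+ k.+2 / 4.
have d0 : 0 < d by rewrite divr_gt0 // exprn_gt0.
have d4 : d <= 1 / 4.
  have : c ^+ k.+2 <= 1 by apply: exprn_ile1; move: c0 c_96; clear; lra.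
  by rewrite /d; clear; lra.
have mrg0 := margin_gt0 R hk; set mrg := margin R k in mrg0.
pose N := (Num.trunc ((4 * 2 ^ k.+1)%:R / mrg)).+1.
have hN : (4 * 2 ^ k.+1)%:R < mrg * N%:R.
  by rewrite mulrC -ltr_pdivrMr //; apply: truncnS_gt.
pose J := (k.-1 * N)%N; pose mu := Num.min d g.
have mu0 : 0 < mu by rewrite lt_min d0 g0.
have [mu_d mu_g] : mu <= d /\ mu <= g by rewrite !ge_min !lexx orbT.
pose q := (Num.trunc ((J * M * M)%:R / mu)).+1.
have hq : (J * M * M)%:R <= mu * q%:R.
  by rewrite mulrC -ler_pdivrMr //; apply/ltW/truncnS_gt.
have [n1 hn1] := eventually_ge (2 * (L * (L + 2))%:R) kappa0.
have [n2 hn2] := eventually_ge (2 * (M * (M + k.+1))%:R) (exprn_gt0 k.+2 c0).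
have [||n3 hn3] := @exp_beats_power R (1 - d) k.+1 q _ _ isT;
  [by move: d4; clear; lra|by move: d0; clear; lra|].
have [n4 hn4] := eventually_ge (2 * (2 * (2 * (k.-1 * N + k) + k.+1))%:R) mrg0.
exists (2 * k * k.+1 * 1024 ^ k + n1 + n2 + n3 + n4)%N => n hn kn H Hn hmc.
have [an0 an1 an2 an3 an4] : [/\ (2 * k * k.+1 * 1024 ^ k <= n)%N, (n1 <= n)%N,
    (n2 <= n)%N, (n3 <= n)%N & (n4 <= n)%N].
  by move: hn; move: (2 * k * k.+1 * 1024 ^ k)%N; clear; split; lia.
rewrite /Defs.order in Hn; rewrite -{}Hn in hn kn hmc an0 an1 an2 an3 an4.
set n' := #|vert H| in hn kn hmc an0 an1 an2 an3 an4.
pose e := (n' - min_codeg H)%N; have hbad : forall T : {set vert H}, #|T| = k.-1 ->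
  (#|bad T| <= e)%N := @card_bad k H.
have heps : e%:R <= (eps R k - g) * n'%:R.
  rewrite /e natrB ?min_codeg_le_order //; move: hmc; clear; lra.
have he : 2 * k%:R ^+ 2 * e%:R + beta * n'%:R <= k.+1%:R * n'%:R :> R.
  have k2 : 0 < 2 * k%:R ^+ 2 :> R by rewrite mulr_gt0 ?exprn_gt0.
  have : 2 * k%:R ^+ 2 * e%:R <= 2 * k%:R ^+ 2 * ((eps R k - g) * n'%:R) by rewrite ler_pM2l.
  have -> : 2 * k%:R ^+ 2 * ((eps R k - g) * n'%:R) = (k%:R + (odd k)%:R) * n'%:R - beta * n'%:R.
    by rewrite /eps /beta; field; rewrite lt0r_neq0.
  have : (k%:R + (odd k)%:R) * n'%:R <= k.+1%:R * n'%:R :> R.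
    by rewrite ler_wpM2r // -natr1 lerD2l lern1 leq_b1.
  by clear; lra.
have V0 : (0 < n')%N.
  by apply: leq_trans an0; rewrite !muln_gt0 expn_gt0 /= (leq_trans _ hk).
have nR0 : 0 < n'%:R :> R by rewrite ltr0n.
have link x y : c <= mean L (fun t : seq (vert H) => (linked x y t)%:R).
  apply: le_trans c_kap _; apply: (linked_dense hk hbad beta0 he an0) => //.
  exact: hn1.
have cld : c <= mean k.+1 (fun t : seq (vert H) => (clique_seq t)%:R).
  apply: le_trans c_96 _; rewrite -[leLHS](avg_const V0); apply: avg_le => x.
  exact: (mean_clique_seq hk hbad beta0 he an0).
have hM : (0 < M)%N by [].
have hmq : mu * q%:R * (n' %/ q)%:R <= mu * n'%:R.
  by rewrite -mulrA ler_pM2l // -natrM ler_nat mulnC leq_trunc_div.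
have hZM : M%:R * (J * ((n' %/ q) * M))%:R <= mu * n'%:R.
  apply: le_trans hmq; rewrite -natrM.
  have -> : (M * (J * (n' %/ q * M)) = J * M * M * (n' %/ q))%N by clear; lia.
  by rewrite natrM ler_wpM2r.
have [|Z [tZ cZ aZ]] := @multi_absorbing_set R k H L c V0 c0 link cld (hn2 _ an2)
    (n' %/ q) (hn3 _ an3) J.
  by rewrite mulrA ler_pdivrMr // (le_trans hZM) // ler_pM2r.
have cZR : #|Z|%:R <= mu * n'%:R.
  apply: le_trans hZM; rewrite -natrM ler_nat (leq_trans cZ) // leq_pmull //.
pose W := ~: Z; have cW : (#|Z| + #|W| = n')%N by apply: cardsC.
have cWR : #|Z|%:R + #|W|%:R = n'%:R :> R by rewrite -natrD cW.
have mun_d : mu * n'%:R <= d * n'%:R by rewrite ler_pM2r.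
have mun_g : mu * n'%:R <= g * n'%:R by rewrite ler_pM2r.
have dn : d * n'%:R <= 1 / 4 * n'%:R by rewrite ler_pM2r.
have eW : e%:R <= eps R k * #|W|%:R.
  have : eps R k * #|Z|%:R <= #|Z|%:R by rewrite ler_piMl //; move: eps1; clear; lra.
  have -> : #|W|%:R = n'%:R - #|Z|%:R :> R by move: cWR; clear; lra.
  by move: heps cZR mun_g; clear; lra.
have W0 : 0 <= #|W|%:R :> R by [].
have [x0 _] := card_gt0P V0.
have [||U [UW tU cU]] := @almost_tiling k H e hk hbad W x0 R mrg N mrg0 hN.
- have := hn4 _ an4; have : mrg * (1 / 2 * n'%:R) <= mrg * #|W|%:R.
    by rewrite ler_pM2l //; move: cWR cZR mun_d dn nR0; clear; lra.
  by move: cWR cZR mun_d dn; clear; lra.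
- have e1 : e%:R <= 1 / 4 * #|W|%:R :> R by apply: le_trans eW _; rewrite ler_wpM2r.
  have e2 : k%:R * e%:R <= k%:R * eps R k * #|W|%:R by rewrite -mulrA ler_pM2l.
  have e3 : k%:R * eps R k * #|W|%:R <= 5 / 8 * #|W|%:R by rewrite ler_wpM2r.
  have l1 : (e <= #|W|)%N by rewrite -(ler_nat R); move: e1 W0; clear; lra.
  have l2 : (k * e <= #|W|)%N by rewrite -(ler_nat R) natrM; move: e2 e3 W0; clear; lra.
  rewrite natrM (natrB _ l1) (natrB _ l2) natrM.
  have -> : (2 / k.+1%:R + mrg) * #|W|%:R ^+ 2 =
     ((1 - eps R k) * #|W|%:R) * ((1 - k%:R * eps R k) * #|W|%:R).
    by rewrite /mrg /margin; ring.
  have f1 : 0 <= 1 - eps R k by move: eps1; clear; lra.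
  have f2 : 0 <= 1 - k%:R * eps R k by move: keps; clear; lra.
  by apply: ler_pM; rewrite ?mulr_ge0 //; move: eW e2; clear; lra.
have dUZ : [disjoint U & Z] by rewrite disjoints_subset.
pose X := W :\: U.
have dXZ : [disjoint X & Z].
  by rewrite disjoints_subset; apply: subsetDl.
have cX : (k.+1 %| #|X|)%N.
  have cWU : (#|U| + #|X| = #|W|)%N by rewrite -(cardsID U W) (setIidPr UW).
  have : (k.+1 %| #|Z| + (#|U| + #|X|))%N by rewrite cWU cW.
  by rewrite (dvdn_addr _ (tileable_card tZ)) (dvdn_addr _ (tileable_card tU)).
have /dvdnP[j cXj] := cX.
have tZX : tileable (Z :|: X).
  apply: (aZ j) => //; move: cU; rewrite -/J -/X cXj => h.
  by apply: leq_trans (ltnW h); rewrite leq_pmulr.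
have -> : [set: vert H] = U :|: (Z :|: X).
  apply/setP => v; rewrite !inE; case: (v \in Z); case: (v \in U) => //.
apply: tileableU => //.
rewrite -setI_eq0 setIUr setU_eq0 !setI_eq0 dUZ /=.
by rewrite -setI_eq0; apply/eqP/setP => v; rewrite !inE; case: (v \in U).
Qed.

(** * Random colourings of a finite set *)

Section RandomColouring.
Variables (R : realFieldType) (U C : finType) (G : {set C}).
Hypothesis C_gt0 : (0 < #|C|)%N.
Implicit Types (F : {ffun U -> C}) (B : {set U}) (Phi : {ffun U -> C} -> R).

Definition expect Phi : R := \sum_F Phi F * #|C|%:R^-1 ^+ #|U|.

Let p : R := #|G|%:R / #|C|%:R.

Definition hits F B := [forall u in B, F u \in G].

Let C0 : #|C|%:R != 0 :> R. Proof. by rewrite lt0r_neq0 // ltr0n. Qed.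

Lemma expectD Phi Psi : expect (fun F => Phi F + Psi F) = expect Phi + expect Psi.
Proof. by rewrite /expect -big_split; apply: eq_bigr => F _; rewrite mulrDl. Qed.

Lemma expectZ a Phi : expect (fun F => a * Phi F) = a * expect Phi.
Proof. by rewrite /expect mulr_sumr; apply: eq_bigr => F _; rewrite mulrA. Qed.

Lemma expect_le Phi Psi : (forall F, Phi F <= Psi F) -> expect Phi <= expect Psi.
Proof.
by move=> le; apply: ler_sum => F _; rewrite ler_wpM2r // exprn_ge0 // invr_ge0.
Qed.

Lemma eq_expect Phi Psi : Phi =1 Psi -> expect Phi = expect Psi.
Proof. by move=> e; apply: eq_bigr => F _; rewrite e. Qed.

Lemma expect_sum (I : finType) (Q : pred I) (Phi : I -> {ffun U -> C} -> R) :
  expect (fun F => \sum_(i | Q i) Phi i F) = \sum_(i | Q i) expect (Phi i).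
Proof.
rewrite /expect exchange_big; apply: eq_bigr => F _; by rewrite mulr_suml.
Qed.

Lemma expect_hits B : expect (fun F => (hits F B)%:R) = p ^+ #|B|.
Proof.
(* The indicator factors over the points, so its sum over all colourings is a
   product of sums over the colours. *)
pose f u c : R := (if u \in B then (c \in G)%:R else 1) * #|C|%:R^-1.
have -> : expect (fun F => (hits F B)%:R) = \sum_(F : {ffun U -> C}) \prod_u f u (F u).
  apply: eq_bigr => F _; rewrite big_split /= prodr_const; congr (_ * _).
  rewrite /hits; case: (boolP [forall u in B, F u \in G]) => [/forall_inP h|].
    by rewrite big1 // => u _; case: ifP => // /h ->.
  rewrite negb_forall => /existsP[u]; rewrite negb_imply => /andP[uB uG].
  by rewrite (bigD1 u) //= uB (negPf uG) mul0r.
rewrite -(bigA_distr_bigA f) /=.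
rewrite (eq_bigr (fun u => if u \in B then p else 1)) => [|u _].
  by rewrite -big_mkcond prodr_const.
rewrite /f -mulr_suml; case: ifP => _.
  rewrite /p -natr_sum; congr (_%:R / _); rewrite -sum1_card [RHS]big_mkcond.
  by apply: eq_bigr => c _; case: (c \in G).
by rewrite sumr_const mulfV.
Qed.

Lemma hits0 F : hits F set0.
Proof. by apply/forall_inP => u; rewrite inE. Qed.

Lemma expect1 : expect (fun=> 1) = 1.
Proof.
rewrite -[RHS](expr0 p) -(cards0 U) -expect_hits; apply: eq_expect => F.
by rewrite hits0.
Qed.

Lemma hitsU F B B' : hits F (B :|: B') = hits F B && hits F B'.
Proof.
apply/forall_inP/andP => [h|[/forall_inP h /forall_inP h'] u /setUP[/h|/h']] //.
by split; apply/forall_inP => u uB; apply: h; rewrite inE uB ?orbT.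
Qed.

Variables (I : eqType) (block : I -> {set U}) (b : nat).

(** Disjoint blocks are coloured independently. The set B0 carries the blocks
already required to be hit, which lets the induction treat the two terms of
(1 + t) ^+ b = 1 + t b, for b in 0, 1, alike. *)
Lemma expect_exp_count t (s : seq I) B0 : uniq s ->
  {in s, forall i, #|block i| = b} -> {in s, forall i, [disjoint B0 & block i]} ->
  {in s &, forall i j, i != j -> [disjoint block i & block j]} ->
  expect (fun F => (hits F B0)%:R * (1 + t) ^+ count (fun i => hits F (block i)) s)
    = p ^+ #|B0| * (1 + t * p ^+ b) ^+ size s.
Proof.
elim: s B0 => [|i s IHs] B0 /=.
  by move=> *; rewrite expr0 mulr1 -expect_hits; apply: eq_expect => F; rewrite mulr1.
move=> /andP[is_ us] cb d0 dd.
have is0 : i \in i :: s by rewrite inE eqxx.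
have sub j : j \in s -> j \in i :: s by rewrite inE => ->; rewrite orbT.
rewrite (eq_expect (Psi := fun F =>
    (hits F B0)%:R * (1 + t) ^+ count (fun i => hits F (block i)) s +
    t * ((hits F (B0 :|: block i))%:R * (1 + t) ^+ count (fun i => hits F (block i)) s))).
  rewrite expectD expectZ IHs // => [|j js|j js|j l js ls]; last 3 first.
  - exact/cb/sub.
  - exact/d0/sub.
  - by apply: dd; apply: sub.
  rewrite IHs // => [|j js|j js|j l js ls].
  - have -> : #|B0 :|: block i| = (#|B0| + b)%N.
      by rewrite cardsU disjoint_setI0 ?d0 // cards0 subn0 cb.
    by rewrite exprD exprS; ring.
  - exact/cb/sub.
  - rewrite -setI_eq0 setIUl setU_eq0 !setI_eq0 (d0 j (sub j js)) /=.
    apply: dd; [exact: is0|exact: sub|by apply: contraNneq is_ => ->].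
  - by apply: dd; apply: sub.
move=> F; rewrite hitsU; case: (hits F B0); rewrite ?mul0r ?mulr0 ?addr0 //=.
by case: (hits F (block i)); rewrite ?add0n ?add1n ?exprS ?mul0r ?mulr0 ?addr0 //=; ring.
Qed.

(** Markov's inequality for (1 + t) ^+ count. *)
Lemma chernoff t (s : seq I) m : uniq s -> 0 <= t ->
  {in s, forall i, #|block i| = b} ->
  {in s &, forall i j, i != j -> [disjoint block i & block j]} ->
  (1 + t) ^+ m * expect (fun F => (m <= count (fun i => hits F (block i)) s)%N%:R)
    <= (1 + t * p ^+ b) ^+ size s.
Proof.
move=> us t0 cb dd; have := @expect_exp_count t s set0 us cb _ dd.
rewrite cards0 expr0 mul1r => <- => [|i _]; last by rewrite -setI_eq0 set0I.
rewrite -expectZ; apply: expect_le => F.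
rewrite hits0 mul1r; case: leqP => [h|_]; last by rewrite mulr0 exprn_ge0 // addr_ge0.
by rewrite mulr1 ler_weXn2l // lerDl.
Qed.

End RandomColouring.

(** * A sparse colouring of the subsets *)

Lemma count_enum (T : finType) (A : {set T}) (a : pred T) :
  count a (enum A) = #|[set v in A | a v]|.
Proof.
by rewrite -sum1_count big_enum_cond /= sum1dep_card.
Qed.

Section Facets.
Variable V : finType.
Implicit Types (T : {set V}) (u v w : V).

(** Only the facets of v |: T that contain v, so that different v give disjoint
families. *)
Definition facets T v := [set v |: (T :\ u) | u in T].

Lemma card_facets T v : v \notin T -> #|facets T v| = #|T|.
Proof.
move=> vT; rewrite card_in_imset // => u w uT wT /setP/(_ u).
rewrite !in_setU1 !in_setD1 eqxx uT andbT /= orbF.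
case: eqVneq => [uv|_ /=]; last by case: (u =P w).
by rewrite uv (negPf vT) in uT.
Qed.

Lemma facets_disjoint T v w : v \notin T -> v != w ->
  [disjoint facets T v & facets T w].
Proof.
move=> vT vw; rewrite disjoints_subset; apply/subsetP => _ /imsetP[u uT ->].
rewrite in_setC; apply/imsetP => -[u' _ /setP/(_ v)].
by rewrite !in_setU1 !in_setD1 eqxx (negPf vw) (negPf vT) !andbF.
Qed.

End Facets.

(** The Chernoff bound with t = 1/16. The constant 2197/6859 is (13/19)^3, and
(1 + t (13/19)^3)^3 < (1 - 1/1000) (1 + t), so that the event of having one third
of all blocks hit has exponentially small probability. *)
Lemma rare_hits (R : realFieldType) (U C : finType) (G : {set C})
    (I : eqType) (block : I -> {set U}) b (s : seq I) k n m :
  (0 < #|C|)%N -> (#|G|%:R / #|C|%:R) ^+ b <= 2197 / 6859 :> R ->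
  uniq s -> {in s, forall i, #|block i| = b} ->
  {in s &, forall i j, i != j -> [disjoint block i & block j]} ->
  (size s <= n)%N -> (n %/ 3 < m + k)%N ->
  expect (fun F : {ffun U -> C} =>
      (m <= count (fun i => hits G F (block i)) s)%N%:R : R)
    <= 2 ^+ k * (1 - 1 / 1000) ^+ (n %/ 3).
Proof.
move=> C0 hp us cb dd sn nm; have t0 : 0 <= 1 / 16 :> R by clear; lra.
have := @chernoff R U C G C0 I block b _ s m us t0 cb dd.
set E := expect _; set z := _ ^+ b in hp * => hE.
have z0 : 0 <= z by rewrite exprn_ge0 // divr_ge0.
have y1 : 1 <= 1 + 1 / 16 * z by move: z0; clear; lra.
have y3 : (1 + 1 / 16 * z) ^+ 3 <= (1 - 1 / 1000) * (1 + 1 / 16) :> R.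
  apply: (@le_trans _ _ ((1 + 1 / 16 * (2197 / 6859)) ^+ 3)); last first.
    by rewrite !exprS expr0; clear; lra.
  by rewrite lerXn2r ?nnegrE //; move: z0 hp; clear; lra.
have t1 : 0 < (1 + 1 / 16) ^+ m :> R by rewrite exprn_gt0 //; clear; lra.
rewrite -(ler_pM2l t1); apply: le_trans hE _.
apply: (@le_trans _ _ ((1 + 1 / 16 * z) ^+ (3 * (n %/ 3).+1))).
  rewrite ler_weXn2l // (leq_trans sn) //.
  by have := divn_eq n 3; have := @ltn_pmod n 3 isT; clear; lia.
rewrite exprM; apply: (@le_trans _ _ (((1 - 1 / 1000) * (1 + 1 / 16)) ^+ (n %/ 3).+1)).
  by rewrite lerXn2r ?nnegrE //; [apply: exprn_ge0; move: y1; clear; lra|clear; lra].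
rewrite exprMn [leRHS]mulrA mulrC; apply: ler_pM; try by apply: exprn_ge0; clear; lra.
  apply: (@le_trans _ _ ((1 + 1 / 16) ^+ (m + k))); first by rewrite ler_weXn2l //; clear; lra.
  rewrite exprD ler_pM2l // lerXn2r ?nnegrE //; clear; lra.
by rewrite exprS ler_piMl ?exprn_ge0 //; clear; lra.
Qed.

Lemma expect_lt1 (R : realFieldType) (U C : finType) (Phi : {ffun U -> C} -> R) :
  (0 < #|C|)%N -> expect Phi < 1 -> exists F, Phi F < 1.
Proof.
move=> C0 h; apply/existsP; apply: contraLR h => /existsPn h; rewrite -leNgt.
by rewrite -(expect1 R U set0 C0); apply: expect_le => F; rewrite leNgt.
Qed.

(** Put each set in L when its random colour among 19 is one of the first 13. For
a fixed T, the events that all facets of v |: T lie in L, for different v, concern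
disjoint blocks of k - 1 >= 3 sets and have probability at most (13/19)^3; the
events that v |: T is outside L are independent as well and have probability 6/19,
which is 2166/6859 and again at most 2197/6859. *)
Lemma sparse_colouring (R : archiRealFieldType) k : (4 <= k)%N -> exists n0, forall V : finType,
  (n0 <= #|V|)%N -> exists L : pred {set V},
    (forall T : {set V}, #|T| = k.-1 ->
      (3 * (#|[set v in ~: T | [forall S in facets T v, L S]]| + k) <= #|V|)%N) /\
    (forall T : {set V}, #|T| = k.-2 -> (3 * (#|[set v in ~: T | ~~ L (v |: T)]| + k) <= #|V|)%N).
Proof.
move=> hk; pose r : R := 1 - 1 / 1000.
have r0 : 0 <= r by rewrite /r; clear; lra.
have [|n1 hn1] := @exp_beats_power _ r k 3 r0 _ isT; first by rewrite /r; clear; lra.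
exists (n1 + 2 ^ k.+1 + 3 * k)%N => V; set n := #|V| => hn.
have [an1 an2 an3] : [/\ (n1 <= n)%N, (2 ^ k.+1 <= n)%N & (3 * k <= n)%N].
  by move: hn; move: (2 ^ k.+1)%N; clear; split; lia.
pose Q : {set 'I_19} := [set c : 'I_19 | (c < 13)%N].
have cQ : #|Q| = 13%N.
  have -> : Q = [set widen_ord (isT : 13 <= 19)%N i | i in 'I_13].
    apply/setP => c; rewrite inE; apply/idP/imsetP => [h|[i _ ->]]; last exact: (ltn_ord i).
    by exists (Ordinal h) => //; apply: val_inj.
  rewrite card_imset ?card_ord // => i j /(congr1 val)/= h; exact: val_inj.
have cQ' : #|~: Q| = 6%N by have := cardsC Q; rewrite cQ card_ord; clear; lia.
have C0 : (0 < #|'I_19|)%N by rewrite card_ord.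
(* The least count c for which 3 (c + k) <= n may fail. *)
pose m := (n %/ 3 + 1 - k)%N.
have nm : (n %/ 3 < m + k)%N by rewrite /m; clear; lia.
pose near T (F : {ffun {set V} -> 'I_19}) :=
  count (fun v => hits Q F (facets T v)) (enum (~: T)).
pose far T (F : {ffun {set V} -> 'I_19}) :=
  count (fun v => hits (~: Q) F [set v |: T]) (enum (~: T)).
pose a := 2 ^+ k * r ^+ (n %/ 3).
have sE (T : {set V}) : (size (enum (~: T)) <= n)%N by rewrite -cardE; apply: max_card.
have hnear (T : {set V}) : #|T| = k.-1 -> expect (fun F => (m <= near T F)%N%:R) <= a.
  move=> cT; apply: (@rare_hits _ _ _ Q _ _ k.-1) => // [||v|v w].
  - rewrite cQ card_ord; apply: (@le_trans _ _ ((13%:R / 19%:R) ^+ 3)); last first.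
      by rewrite !exprS expr0; clear; lra.
    by rewrite ler_wiXn2l //; [clear; lra|clear; lra|rewrite -ltnS prednK // (leq_trans _ hk)].
  - exact: enum_uniq.
  - by rewrite mem_enum in_setC => /card_facets ->.
  - by rewrite mem_enum in_setC => vT _; apply: facets_disjoint.
have hfar (T : {set V}) : #|T| = k.-2 -> expect (fun F => (m <= far T F)%N%:R) <= a.
  move=> cT; apply: (@rare_hits _ _ _ (~: Q) _ _ 1%N) => // [||v|v w].
  - by rewrite cQ' card_ord expr1; clear; lra.
  - exact: enum_uniq.
  - by rewrite cards1.
  - rewrite !mem_enum !in_setC => vT _ vw; rewrite disjoints1 in_set1.
    by apply/eqP => /setP/(_ v); rewrite !in_setU1 eqxx (negPf vw) (negPf vT).
have n0 : (0 < n)%N by apply: leq_trans an2; rewrite expn_gt0.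
have a0 : 0 <= a by rewrite mulr_ge0 ?exprn_ge0.
have sum_le j (Phi : {set V} -> {ffun {set V} -> 'I_19} -> R) : (j < k)%N ->
    (forall T : {set V}, #|T| = j -> expect (Phi T) <= a) ->
    expect (fun F => \sum_(T : {set V} | #|T| == j) Phi T F) <= n%:R ^+ k.-1 * a.
  move=> jk h; rewrite expect_sum; apply: (@le_trans _ _ (\sum_(T : {set V} | #|T| == j) a)).
    by apply: ler_sum => T /eqP; apply: h.
  rewrite sumr_const -[leLHS]mulr_natl ler_wpM2r // -natrX ler_nat.
  have -> : #|[pred T : {set V} | #|T| == j]| = 'C(n, j).
    have := @card_draws V j; rewrite cardsE => <-. by apply: eq_card.
  apply: leq_trans (bin_le_expn _ _) _; rewrite leq_pexp2l //.
  by rewrite -ltnS prednK // (leq_trans _ hk).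
have [|F hF] := @expect_lt1 _ _ _ (fun F : {ffun {set V} -> 'I_19} =>
   \sum_(T : {set V} | #|T| == k.-1) (m <= near T F)%N%:R +
   \sum_(T : {set V} | #|T| == k.-2) (m <= far T F)%N%:R : R) C0.
  rewrite expectD; apply: (@le_lt_trans _ _ (2 * (n%:R ^+ k.-1 * a))).
    rewrite mulrC mulrDr mulr1; apply: lerD; apply: sum_le => //.
      by rewrite prednK // (leq_trans _ hk).
    by move: hk; clear; lia.
  have nR : 0 < n%:R :> R by rewrite ltr0n.
  have -> : 2 * (n%:R ^+ k.-1 * a) = 2 ^+ k.+1 / n%:R * (r ^+ (n %/ 3) * n%:R ^+ k).
    have -> : n%:R ^+ k = n%:R * n%:R ^+ k.-1 :> R.
      by rewrite -exprS prednK // (leq_trans _ hk).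
    by rewrite /a exprS; field; rewrite lt0r_neq0.
  apply: le_lt_trans (hn1 n an1); rewrite ler_piMl ?mulr_ge0 ?exprn_ge0 //.
  by rewrite ler_pdivrMr // mul1r -natrX ler_nat.
have small c : ~~ (m <= c)%N -> (3 * (c + k) <= n)%N.
  rewrite -ltnNge /m => h.
  have : (c + k <= n %/ 3)%N by move: h; clear; lia.
  by move=> h'; apply: leq_trans (leq_trunc_div n 3); rewrite mulnC leq_mul2r h'.
have none (I : finType) (P b : pred I) x : 0 <= x -> \sum_(i | P i) (b i)%:R + x < 1 :> R ->
    forall i, P i -> ~~ b i.
  move=> x0 h i Pi; apply: contraTN h => bi; rewrite -leNgt (bigD1 i) //= bi.
  by rewrite -addrA lerDl addr_ge0 // sumr_ge0.
exists (fun S => F S \in Q); split=> T cT.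
  have := small _ (none _ _ _ _ _ hF T _); rewrite cT eqxx /near count_enum.
  by move=> -> //; apply: sumr_ge0.
rewrite addrC in hF; have := small _ (none _ _ _ _ _ hF T _); rewrite cT eqxx /far count_enum.
move=> h; suff -> : [set v in ~: T | F (v |: T) \notin Q] =
  [set v in ~: T | hits (~: Q) F [set v |: T]] by apply: h => //; apply: sumr_ge0.
apply/setP => v; rewrite !in_set; congr (_ && _).
by apply/idP/forall_inP => [h' S /set1P ->|/(_ _ (set11 _))]; rewrite !in_set.
Qed.

(** * A graph with an uncoverable vertex *)

Section Uncoverable.
Variables (V : finType) (k : nat) (x : V) (L : pred {set V}).
Implicit Types (S T : {set V}).

(** The two rules are chosen to contradict each other on a clique through x. *)
Definition unc_edges := [set S : {set V} | (#|S| == k) &&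
  (if x \in S then L (S :\ x) else ~~ [forall u in S, L (S :\ u)])].

Lemma unc_uniform S : S \in unc_edges -> #|S| = k.
Proof. by rewrite inE => /andP[/eqP]. Qed.

Definition uncoverable : kgraph k := KGraph unc_uniform.

(** If K were a clique through x, every k-subset of K through x would put a
(k-1)-subset of K without x into L, and this covers all the facets of the edge
K :\ x. *)
Lemma uncoverable_clique (K : {set vert uncoverable}) : clique K -> x \notin K.
Proof.
move=> cK; apply/negP => xK.
have := clique_edge cK xK; rewrite in_set setD11 => /andP[_ /forall_inPn[u]].
rewrite in_setD1 => /andP[ux uK] /negP; apply.
have := clique_edge cK uK; rewrite in_set in_setD1 xK [x == u]eq_sym ux => /andP[_].
by rewrite setDDl setUC -setDDl.
Qed.

Lemma uncoverable_no_factor : ~ has_factor (complete k k.+1) uncoverable.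
Proof.
move=> [P /and3P[/eqP cP _ _] hP].
have : x \in cover P by rewrite cP.
move=> /bigcupP[B /hP[f /copy_clique/uncoverable_clique/negP]]; exact.
Qed.

Hypothesis k_gt0 : (0 < k)%N.
Hypothesis near : forall T, #|T| = k.-1 ->
  (3 * (#|[set v in ~: T | [forall S in facets T v, L S]]| + k) <= #|V|)%N.
Hypothesis far : forall T, #|T| = k.-2 ->
  (3 * (#|[set v in ~: T | ~~ L (v |: T)]| + k) <= #|V|)%N.

Lemma uncoverable_bad (T : {set vert uncoverable}) : #|T| = k.-1 ->
  (3 * #|bad T| <= #|V|)%N.
Proof.
move=> cT; have cvT v : v \notin T -> #|v |: T| = k.
  by move=> vT; rewrite cardsU1 vT cT add1n prednK.
have [xT|xT] := boolP (x \in T).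
  have cx : #|T :\ x| = k.-2 by have := cardsD1 x T; rewrite xT cT add1n => ->.
  apply: leq_trans (far cx); rewrite leq_mul2l /=.
  set X := [set v in _ | _].
  apply: (@leq_trans #|T :|: X|); last first.
    by rewrite (leq_trans (leq_card_setU _ _)) // addnC leq_add2l cT leq_pred.
  apply/subset_leq_card/subsetP => v; rewrite in_set in_setU.
  have [//|vT /=] := boolP (v \in T); have vx : x != v by apply: contraNneq vT => <-.
  rewrite [v \in X]in_set in_setC in_setD1 (negPf vT) andbF /=; apply: contraNN.
  move=> Lv; rewrite in_set cvT // eqxx in_setU1 xT orbT /=.
  by rewrite setDUl (setDidPl _) // disjoint_sym disjoints1 in_set1.
apply: leq_trans (near cT); rewrite leq_mul2l /=.
set X := [set v in _ | _].
apply: (@leq_trans #|(x |: T) :|: X|); last first.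
  by rewrite (leq_trans (leq_card_setU _ _)) // addnC leq_add2l cvT.
apply/subset_leq_card/subsetP => v; rewrite in_set in_setU.
have [//|] := boolP (v \in x |: T); rewrite in_setU1 negb_or => /andP[vx vT] /=.
rewrite in_set cvT // eqxx in_setU1 eq_sym (negPf vx) (negPf xT) /= negbK => /forall_inP h.
rewrite [v \in X]in_set in_setC vT; apply/forall_inP => _ /imsetP[u uT ->].
have vu : u != v by apply: contraNneq vT => <-.
have := h u; rewrite in_setU1 uT orbT setDUl (setDidPl _) //; first exact.
by rewrite disjoint_sym disjoints1 in_set1.
Qed.

Lemma uncoverable_codeg : (2 * #|V| <= 3 * min_codeg uncoverable)%N.
Proof.
apply: (big_ind (fun m => 2 * #|V| <= 3 * m)%N) => [|a b|T /eqP cT].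
- by rewrite leq_mul2r orbT.
- by rewrite /minn; case: ifP.
by move: (uncoverable_bad cT) (codeg_bad T) => /=; clear; lia.
Qed.

End Uncoverable.

Lemma exists_uncoverable (R : archiRealFieldType) k : (4 <= k)%N ->
  exists n0, forall n, (n0 <= n)%N -> exists H : kgraph k,
    [/\ Defs.order H = n, (2 * n <= 3 * min_codeg H)%N &
        ~ has_factor (complete k k.+1) H].
Proof.
move=> hk; have [n0 hn0] := sparse_colouring R hk.
exists n0.+1 => -[//|n] hn; have [|L [near far]] := hn0 'I_n.+1.
  by rewrite card_ord ltnW.
exists (uncoverable k ord0 L); split.
- exact: card_ord.
- rewrite -{1}(card_ord n.+1); apply: uncoverable_codeg near far.
  by rewrite (leq_trans _ hk).
- exact: uncoverable_no_factor.
Qed.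

Theorem theorem1p3 (R : realType) (k : nat) (hk : (4 <= k)%N)
    (gamma : R) (hgamma : 0 < gamma) :
  exists n0 : nat, forall n : nat, (n0 <= n)%N -> (k.+1 %| n)%N ->
    (clique_factor_threshold k n k.+1)%:R
      <= (1 - (k%:R + (odd k)%:R) / (2 * k%:R ^+ 2) + gamma) * n%:R
    /\ (~~ odd k ->
        2 * n%:R / 3 <= (clique_factor_threshold k n k.+1)%:R :> R).
Proof.
have g2 : 0 < gamma / 2 by rewrite divr_gt0.
have [n1 hn1] := tileable_of_codegree hk g2.
have [n2 hn2] := exists_uncoverable R hk.
have [n3 hn3] := eventually_ge 1 g2.
have [eps0 eps1 _] := eps_facts R hk.
exists (n1 + n2 + n3)%N => n hn kn.
have [an1 an2 an3] : [/\ (n1 <= n)%N, (n2 <= n)%N & (n3 <= n)%N].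
  by move: hn; clear; split; lia.
have [forces least] := clique_factor_thresholdP k n k.+1.
split=> [|_]; last first.
  have [H [oH dH nH]] := hn2 n an2; rewrite ler_pdivrMr // -!natrM ler_nat mulnC.
  rewrite leqNgt; apply/negP => lt; apply/nH/forces => //.
  by move: lt dH; clear; lia.
(* The integer d = trunc y + 1 lies above y, hence forces a factor, and it is at
   most y + 1, where the 1 is paid for by the other half of gamma. *)
pose y : R := (1 - eps R k + gamma / 2) * n%:R.
have y0 : 0 <= y by rewrite mulr_ge0 //; move: eps1 g2; clear; lra.
apply: (@le_trans _ _ (Num.trunc y).+1%:R).
  rewrite ler_nat; apply: least => H oH dH; apply/tileable_factor.
  apply: (hn1 n) => //; apply: le_trans (ltW (truncnS_gt y)) _.
  by rewrite ler_nat.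
have /andP[+ _] := truncn_itv y0; rewrite -natr1 /y; have := hn3 n an3; rewrite -/(eps R k).
by clear; lra.
Qed.
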